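(* Let $G$ be a finite group. If every Schmidt subgroup of $G$ is modular in $G$, then the quotient group $G/F(G)$ is cyclic.
   Context: All groups are finite. A Schmidt group is a non-nilpotent group all of whose proper subgroups are nilpotent. A Schmidt subgroup of $G$ is a subgroup of $G$ that is a Schmidt group. $F(G)$ denotes the Fitting subgroup of $G$ (the largest nilpotent normal subgroup). A subgroup $M$ of $G$ is modular in $G$ if $M$ is a modular element of the lattice of subgroups of $G$, that is, (i) $\langle X, M\cap Z\rangle=\langle X,M\rangle\cap Z$ for all subgroups $X\le Z\le G$, and (ii) $\langle M, Y\cap Z\rangle=\langle M,Y\rangle\cap Z$ for all subgroups $Y, Z\le G$ with $M\le Z$. *)

(* Defs.v *)
From mathcomp Require Import all_boot all_fingroup all_solvable.

Set Implicit Arguments.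
Unset Strict Implicit.
Unset Printing Implicit Defensive.

Local Open Scope group_scope.

Definition schmidt_group (gT : finGroupType) (S : {group gT}) : Prop :=
  ~~ nilpotent S /\ (forall H : {group gT}, H \proper S -> nilpotent H).

(* [M] is a modular element of the lattice of subgroups of [G]; this notion is
   unrelated to the modular p-groups ['Mod_m]. *)
Definition modular_subgroup (gT : finGroupType) (G M : {group gT}) : Prop :=
  [/\ M \subset G,
      forall X Z : {group gT}, X \subset Z -> Z \subset G ->
        X <*> (M :&: Z) = (X <*> M) :&: Z
    & forall Y Z : {group gT}, Y \subset G -> Z \subset G -> M \subset Z ->
        M <*> (Y :&: Z) = (M <*> Y) :&: Z].

(* Main.v *)
Require Import Defs.
From mathcomp Require Import all_boot all_fingroup all_solvable.
From mathcomp Require Import ssralg finalg zmodp.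
From mathcomp Require Import mxrepresentation mxabelem vcharacter.

Set Implicit Arguments.
Unset Strict Implicit.
Unset Printing Implicit Defensive.

Local Open Scope group_scope.

(**
  Schmidt groups do not behave well under quotients, so the hypothesis is first
  traded for the property [coprime_modular]: whenever a q-element [y] acts
  nontrivially on a p-group [P] with [y ^+ q] acting trivially, there is a
  [y]-invariant [P0] inside [P] with [P0 <*> <[y]>] modular.  A minimal
  non-nilpotent subgroup of [P <*> <[y]>] provides [P0] (schmidt_coprime), and
  the property passes to subgroups and, because Sylow subgroups of a preimage
  lift coprime actions, to quotients.

  It forces solubility.  A minimal counterexample is simple with soluble proper
  subgroups.  If these are all nilpotent, its maximal subgroups meet trivially
  and are Frobenius complements, so Frobenius' theorem contradicts simplicity.
  Otherwise there is a proper nontrivial modular subgroup; joins of modular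
  subgroups being modular, a largest one [M] can be taken, and [M] is a maximal
  subgroup.  Modularity then makes [M :^ g :&: X] maximal in every [X] not
  inside [M :^ g].  If [X] is the normaliser of a Sylow subgroup [R] for the
  smallest prime divisor of the order, this puts [[~: R, X]] inside every
  conjugate of [M], so that [R] is central in its normaliser, and Burnside's
  transfer argument finishes.

  In a soluble group it forces [G / 'F(G)] to be nilpotent.  A minimal
  counterexample induces a non-nilpotent group [G / 'C_G(N)] on a minimal normal
  subgroup [N].  Then some [M = P0 <*> <[y]>] with [M :&: N = 1] is modular,
  where [y] acts nontrivially and coprimely on a normal r-subgroup of
  [G / 'C_G(N)].  But a modular subgroup that meets [N] trivially normalises
  every subgroup of [N], so [y] and its conjugates act on [N] by power
  automorphisms and commute modulo ['C_G(N)]; coprimality then makes the action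
  of [y] on that r-subgroup trivial.

  What remains is that each Sylow subgroup of the nilpotent group [G / 'F(G)] is
  cyclic.  Such a group is [Q / 'C_Q(V)], where [V] is the q'-part of ['F(G)].
  Two commuting independent elements of order q would contradict modularity
  (coprime_modular_abelem2), so this q-group has rank at most 1, which settles
  odd q.  For q = 2, let [x] in [V] have prime order and be inverted by the unique
  involution of [Q / 'C_Q(V)].  By modularity [Q] normalises [<[x]>], which
  excludes generalised quaternion groups by making [Q / 'C_Q(V)] abelian.
*)

(** * Modular elements of the subgroup lattice *)

Section ModularLattice.

Variable gT : finGroupType.
Implicit Types G H K M N X Y Z : {group gT}.

Lemma modular_sub G M : modular_subgroup G M -> M \subset G.
Proof. by case. Qed.

(** The reverse inclusions hold in every lattice: only these two express the
    modular law. *)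
Lemma modularI G M :
    M \subset G ->
    (forall X Z, X \subset Z -> Z \subset G ->
       (X <*> M) :&: Z \subset X <*> (M :&: Z)) ->
    (forall Y Z, Y \subset G -> Z \subset G -> M \subset Z ->
       (M <*> Y) :&: Z \subset M <*> (Y :&: Z)) ->
  modular_subgroup G M.
Proof.
move=> sMG mod1 mod2; split=> // [X Z sXZ sZG | Y Z sYG sZG sMZ].
  apply/eqP; rewrite eqEsubset mod1 // andbT subsetI !join_subG sXZ subsetIr.
  by rewrite joing_subl (subset_trans (subsetIl _ _)) ?joing_subr.
apply/eqP; rewrite eqEsubset mod2 // andbT subsetI !join_subG sMZ subsetIr.
by rewrite joing_subl (subset_trans (subsetIl _ _)) ?joing_subr.
Qed.

(** The second law for [M :&: H] comes from the one for [M] with [Z] enlarged to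
    [Z <*> M]: the first law shows that this join meets [H] in [Z] again. *)
Lemma modular_setI G H M :
  modular_subgroup G M -> H \subset G -> modular_subgroup H (M :&: H).
Proof.
case=> sMG mod1 mod2 sHG; apply: modularI; first exact: subsetIr.
  move=> X Z sXZ sZH; have sZG := subset_trans sZH sHG.
  rewrite -setIA (setIidPr sZH) mod1 // setSI //.
  by rewrite genS // setUS // subsetIl.
move=> Y Z sYH sZH sMHZ; have [sYG sZG] := (subset_trans sYH sHG, subset_trans sZH sHG).
have sYZG : Y :&: Z \subset G by rewrite subIset ?sYG.
have sZMG : Z <*> M \subset G by rewrite join_subG sZG.
have defZ : (Z <*> M) :&: H = Z.
  by rewrite -mod1 // (joing_idPl sMHZ).
have defYZ : Y :&: (Z <*> M) = Y :&: Z.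
  by rewrite -{1}(setIidPl sYH) -setIA [H :&: _]setIC defZ.
have -> : (M :&: H) <*> (Y :&: Z) = (M <*> (Y :&: Z)) :&: H.
  rewrite joingC [M <*> _]joingC.
  by rewrite (mod1 (Y :&: Z)%G) // subIset ?sYH.
rewrite -defYZ (mod2 Y (Z <*> M)%G) ?joing_subr //.
rewrite -setIA defZ setSI //.
by rewrite genS // setSU // subsetIl.
Qed.

Lemma modularS G H M :
  modular_subgroup G M -> M \subset H -> H \subset G -> modular_subgroup H M.
Proof.
move=> modM sMH sHG; have := modular_setI modM sHG.
by have -> : (M :&: H)%G = M by apply/val_inj/setIidPl.
Qed.

Lemma modularJ G M g :
  modular_subgroup G M -> g \in G -> modular_subgroup G (M :^ g).
Proof.
move=> modM Gg; have [sMG mod1 mod2] := modM.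
have sub_conj (A : {group gT}) : A \subset G -> A :^ g^-1 \subset G.
  by move=> sAG; rewrite sub_conjgV conjGid.
apply: modularI => [|X Z sXZ sZG | Y Z sYG sZG sMZ].
- by rewrite -(conjGid Gg) conjSg.
- have := mod1 (X :^ g^-1)%G (Z :^ g^-1)%G; rewrite /= conjSg => defXZ.
  rewrite -(conjSg _ _ g^-1) conjIg !conjYg conjIg conjsgK.
  by rewrite defXZ ?sub_conj.
have := mod2 (Y :^ g^-1)%G (Z :^ g^-1)%G; rewrite /= -sub_conjg => defYZ.
rewrite -(conjSg _ _ g^-1) conjIg !conjYg conjIg conjsgK.
by rewrite defYZ ?sub_conj.
Qed.

(** Each inclusion is the modular law of one of the two subgroups, applied
    after the other one has been absorbed in the bounds of the interval. *)
Lemma modularY G M1 M2 :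
    modular_subgroup G M1 -> modular_subgroup G M2 ->
  modular_subgroup G (M1 <*> M2).
Proof.
case=> sM1G mod11 mod12 [sM2G mod21 mod22].
apply: modularI => [|X Z sXZ sZG | Y Z sYG sZG /=]; first by rewrite join_subG sM1G.
  have sXG := subset_trans sXZ sZG.
  pose W := (Z <*> M1)%G; pose B := ((M1 <*> M2) :&: W)%G.
  have sWG : W \subset G by rewrite join_subG sZG.
  have sM1B : M1 \subset B by rewrite subsetI !joing_subl joing_subr.
  have sBG : B \subset G by rewrite subIset // join_subG sM1G sM2G.
  have defB : M1 <*> (Z :&: B) = B.
    rewrite (mod12 Z B) // joingC; apply/setIidPr.
    exact: subsetIr.
  have sZB : Z :&: B \subset (M1 <*> M2) :&: Z.
    by rewrite setIC setSI // subsetIl.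
  have sX1W : X <*> M1 \subset W by rewrite genS // setSU.
  have : (X <*> (M1 <*> M2)) :&: W \subset X <*> B.
    have -> : B = M1 <*> (M2 :&: W) :> {set gT} by rewrite mod12 ?joing_subr.
    by rewrite joingA -(mod21 (X <*> M1)%G W) // joingA.
  move/(setSI Z); rewrite -setIA (setIidPr (joing_subl Z M1)) => sXZ'.
  apply: subset_trans sXZ' _; rewrite -defB [M1 <*> _]joingC joingA /=.
  rewrite -(mod11 (X <*> (Z :&: B))%G) //; last by rewrite join_subG sXZ subsetIl.
  rewrite join_subG genS ?setUS //= (subset_trans _ (joing_subr _ _)) //.
  by rewrite setSI // joing_subl.
rewrite join_subG => /andP[sM1Z sM2Z].
rewrite -!joingA (mod22 Y Z) // (mod12 (M2 <*> Y)%G Z) //.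
by rewrite join_subG sM2G.
Qed.

Lemma normal_modular G N : N <| G -> modular_subgroup G N.
Proof.
case/andP=> sNG nNG; apply: modularI => // [X Z sXZ sZG | Y Z sYG sZG sNZ].
  have sXG := subset_trans sXZ sZG.
  rewrite norm_joinEl ?(subset_trans sXG) // -group_modl //.
  by rewrite mul_subG ?joing_subr ?joing_subl.
rewrite norm_joinEr ?(subset_trans sYG) // -group_modl //.
by rewrite mul_subG ?joing_subr ?joing_subl.
Qed.

Lemma modularYn G M N :
  modular_subgroup G M -> N <| G -> modular_subgroup G (M <*> N).
Proof. by move=> modM /normal_modular/(modularY modM). Qed.

End ModularLattice.

Section ModularNormal.

Variable gT : finGroupType.
Implicit Types G M N X Y Z : {group gT}.

(** After replacing [M] by the modular subgroup [M <*> N], the laws in the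
    quotient are those of [G] between subgroups that contain [N]. *)
Lemma modular_quotient G M N :
  modular_subgroup G M -> N <| G -> modular_subgroup (G / N) (M / N).
Proof.
move=> modM nsNG; have [sMG mod1 mod2] := modularYn modM nsNG.
have nNM : M \subset 'N(N) := subset_trans (modular_sub modM) (normal_norm nsNG).
have nN (A : {group gT}) : A \subset G -> A \subset 'N(N).
  by move=> sAG; apply: subset_trans sAG (normal_norm nsNG).
have -> : (M / N)%G = ((M <*> N) / N)%G.
  by apply: val_inj; rewrite /= quotientYidr.
have sNM : N \subset M <*> N by rewrite joing_subr.
apply: modularI; first exact: quotientS.
  move=> X1 Z1 sXZ sZG; have [Z defZ sNZ sZ] := inv_quotientS nsNG sZG.
  have nsNZ : N <| Z by apply: normalS nsNG.
  rewrite defZ in sXZ; have [X defX sNX sX] := inv_quotientS nsNZ sXZ.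
  have sXG := subset_trans sX sZ.
  rewrite defX defZ /= -quotientGI // -!quotientY ?nN //.
    by rewrite -quotientIG // (mod1 X Z).
  by rewrite subIset ?sMG.
move=> Y1 Z1 sYG sZG sMZ; have [Z defZ sNZ sZ] := inv_quotientS nsNG sZG.
have [Y defY sNY sY] := inv_quotientS nsNG sYG.
rewrite defY defZ /= -quotientGI // -!quotientY ?nN //.
  rewrite -quotientIG // (mod2 Y Z) //.
  by rewrite -(quotientSGK (nN _ sMG) sNZ) -defZ.
by rewrite subIset ?sY.
Qed.

(** The first law with [Z := N] gives [X = (X <*> M) :&: N], and [M] normalises
    both factors. *)
Lemma modular_norm_TI G M N X :
    modular_subgroup G M -> N <| G -> M :&: N = 1 -> X \subset N ->
  M \subset 'N(X).
Proof.
case=> sMG mod1 _ nsNG tiMN sXN.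
have := mod1 X N sXN (normal_sub nsNG).
rewrite tiMN joingG1 => defX.
rewrite defX normsI ?(subset_trans sMG (normal_norm nsNG)) //.
by rewrite (subset_trans (joing_subr X M)) ?normG.
Qed.

End ModularNormal.

(** * Coprime action *)

Section Coprime.

Variable gT : finGroupType.
Implicit Types A G H P : {group gT}.

Lemma coprime_mul_cent A G H :
    A \subset 'N(G) -> A \subset 'N(H) -> H <| G -> coprime #|G| #|A| ->
    solvable G -> [~: G, A] \subset H ->
  H * 'C_G(A) = G.
Proof.
move=> nGA nHA nsHG coGA solG sGAH; have [sHG nHG] := andP nsHG.
have defC : 'C_G(A) / H = G / H.
  rewrite coprime_quotient_cent //; apply/setIidPl.
  by rewrite quotient_cents2.
rewrite -quotientK ?subIset ?nHG // defC quotientGK //.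
Qed.

(** [G] is the product of [[~: G, A]] and of ['C_G(A)]. *)
Lemma coprime_cent_commg A G :
    A \subset 'N(G) -> coprime #|G| #|A| -> solvable G ->
    A \subset 'C([~: G, A]) ->
  A \subset 'C(G).
Proof.
move=> nGA coGA solG cGAA.
have sGAG : [~: G, A] \subset G by rewrite commg_subl.
rewrite centsC -(@coprime_mul_cent A G [~: G, A]) //.
- by rewrite mul_subG ?subsetIr // centsC.
- exact: commg_normr.
- by rewrite /normal sGAG commg_norml.
Qed.

Lemma coprime_pgroups (p q : nat) (P Q : {group gT}) :
  p != q -> p.-group P -> q.-group Q -> coprime #|P| #|Q|.
Proof.
move=> neq_pq pP qQ; apply: pnat_coprime pP _.
by apply: sub_in_pnat qQ => r _ /eqP->; rewrite !inE eq_sym.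
Qed.

Lemma min_power_notin (q : nat) y G :
    q.-elt y -> y \notin G ->
  exists k, y ^+ (q ^ k)%N \notin G /\ y ^+ (q ^ k.+1)%N \in G.
Proof.
move=> qy nGy; have /p_natP[n oy] : q.-nat #[y] by [].
have exn : exists k, y ^+ (q ^ k)%N \in G by exists n; rewrite -oy expg_order.
case: (ex_minnP exn) => [[|k] Gyk mink]; first by rewrite expg1 (negbTE nGy) in Gyk.
exists k; split=> //; apply: contraTN (ltnSn k) => Gyk'.
by rewrite -leqNgt; apply: mink.
Qed.

(** The automorphisms of a cyclic group commute. *)
Lemma cyclic_norm_commg (x g h : gT) :
  g \in 'N(<[x]>) -> h \in 'N(<[x]>) -> [~ g, h] \in 'C[x].
Proof.
have commutes (a b : gT) : a \in 'N(<[x]>) -> b \in 'N(<[x]>) ->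
    x ^ (a * b) = x ^ (b * a).
  move=> nxa nxb; have /cycleP[i xa] : x ^ a \in <[x]> by rewrite memJ_norm ?cycle_id.
  have /cycleP[j xb] : x ^ b \in <[x]> by rewrite memJ_norm ?cycle_id.
  by rewrite !conjgM xa xb !conjXg xa xb -!expgM mulnC.
move=> nxg nxh; apply/cent1P/commute_sym/commgP/conjg_fixP.
have := commutes g^-1 h^-1; rewrite !groupV => /(_ nxg nxh) eq_x.
rewrite commgEl conjgE !mulgA -[_ * h]mulgA conjgM eq_x -conjgM.
by rewrite mulgA mulgKV mulVg conjg1.
Qed.

End Coprime.

(** * From Schmidt subgroups to coprime actions *)

Lemma schmidt_exists (gT : finGroupType) (H : {group gT}) :
  ~~ nilpotent H -> exists2 S : {group gT}, S \subset H & schmidt_group S.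
Proof.
move=> nnilH; have [S /mingroupP[nnilS minS] sSH] :=
  mingroup_exists (gP := fun K : {group gT} => ~~ nilpotent K) nnilH.
exists S => //; split=> // K /properP[sKS [x Sx nKx]].
by apply: contraR nKx => nnilK; rewrite (minS K).
Qed.

(** The form of the hypothesis that is inherited by quotients.  The subgroup [P0]
    may be trivial or centralised by [y]: if [y] has order [q] and acts
    nontrivially on a cyclic group [P] of order [p ^ 2] with subgroup [N] of
    order [p], then the Schmidt subgroups of [P <*> <[y]>] are the conjugates
    of [N <*> <[y]>], and their p-parts vanish modulo [N]. *)
Definition coprime_modular (gT : finGroupType) (G : {group gT}) : Prop :=
  forall (p q : nat) (P : {group gT}) (y : gT),
    p != q -> p.-group P -> q.-elt y -> P \subset G -> y \in G ->
    y \in 'N(P) -> y \notin 'C(P) -> y ^+ q \in 'C(P) ->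
  exists P0 : {group gT},
    [/\ P0 \subset P, y \in 'N(P0) & modular_subgroup G (P0 <*> <[y]>)].

Lemma coprime_modularS (gT : finGroupType) (G H : {group gT}) :
  H \subset G -> coprime_modular G -> coprime_modular H.
Proof.
move=> sHG modG p q P y neq_pq pP qy sPH Hy nPy nCPy CPyq.
have [P0 [sP0P nP0y modM]] := modG p q P y neq_pq pP qy
  (subset_trans sPH sHG) (subsetP sHG y Hy) nPy nCPy CPyq.
exists P0; split=> //; apply: modularS modM _ sHG.
by rewrite join_subG (subset_trans sP0P) // cycle_subG.
Qed.

Lemma pgroup_cycle_sub_or_eq (gT : finGroupType) (q : nat) (y : gT) (Q : {group gT}) :
  q.-elt y -> Q \subset <[y]> -> Q :=: <[y]> \/ Q \subset <[y ^+ q]>.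
Proof.
move=> qy sQy; have [Qy | nQy] := boolP (y \in Q).
  by left; apply/eqP; rewrite eqEsubset sQy cycle_subG.
right; apply/subsetP=> u Qu; have /cycleP[i def_u] := subsetP sQy u Qu.
have [/dvdnP[j def_i] | nq_i] := boolP (q %| i).
  by rewrite def_u def_i mulnC expgM mem_cycle.
have co_yi : coprime #[y] i.
  have [y1 | nty] := eqVneq y 1; first by rewrite y1 group1 in nQy.
  have pr_q : prime q.
    by rewrite -(pdiv_p_elt qy nty) pdiv_prime // order_gt1.
  by apply: pnat_coprime qy _; rewrite p'natE.
case/negP: nQy; rewrite -cycle_subG.
have /eqP-> : <[y]> == <[u]> by rewrite -/(generator <[y]> u) def_u generator_coprime.
by rewrite cycle_subG.
Qed.

(** As [P <*> <[y]>] is not nilpotent, it contains a Schmidt subgroup [S], which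
    is the product of [P :&: S] and of a p'-group that can be conjugated into
    [<[y]>].  The conjugate must be the whole of [<[y]>], because the proper
    subgroups of [<[y]>] centralise [P]. *)
Lemma schmidt_coprime (gT : finGroupType) (G P : {group gT}) (p q : nat) (y : gT) :
    (forall S : {group gT}, S \subset G -> schmidt_group S ->
       modular_subgroup G S) ->
    p != q -> p.-group P -> q.-elt y -> P \subset G -> y \in G ->
    y \in 'N(P) -> y \notin 'C(P) -> y ^+ q \in 'C(P) ->
  exists P0 : {group gT},
    [/\ P0 \subset P, y \in 'N(P0), y \notin 'C(P0)
      & modular_subgroup G (P0 <*> <[y]>)].
Proof.
move=> modG neq_pq pP qy sPG Gy nPy nCPy CPyq.
have nPY : <[y]> \subset 'N(P) by rewrite cycle_subG.
pose H := (P <*> <[y]>)%G; have defH : P * <[y]> = H by rewrite /= norm_joinEr.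
have coPY : coprime #|P| #|<[y]>| := coprime_pgroups neq_pq pP qy.
have sHG : H \subset G by rewrite join_subG sPG cycle_subG.
have nsPH : P <| H by rewrite /normal joing_subl join_subG normG.
have solH : solvable H.
  rewrite (series_sol nsPH) (pgroup_sol pP) /= quotientYidl //.
  by rewrite abelian_sol ?quotient_abelian ?cycle_abelian.
have [S sSH schS] : exists2 S : {group gT}, S \subset H & schmidt_group S.
  apply: schmidt_exists; apply: contra nCPy => nilH; rewrite -cycle_subG.
  by rewrite (sub_nilpotent_cent2 nilH) ?joing_subl ?joing_subr.
have p'Y : p^'.-group <[y]>.
  by apply: sub_in_pnat qy => r _ /eqP->; rewrite !inE eq_sym.
have [hallP hallY] := coprime_mulpG_Hall defH pP p'Y.
have [Q hallQ] := Hall_exists p^' (solvableS sSH solH).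
have nsPS : P :&: S <| S.
  by rewrite /normal subsetIr normsI ?normG // (subset_trans sSH) // normal_norm.
have hallPS := setI_normal_Hall nsPH hallP sSH.
have defS : (P :&: S) * Q = S.
  by apply/sdprodW; apply/(sdprod_normal_p'HallP nsPS hallQ).
have sQH := subset_trans (pHall_sub hallQ) sSH.
have [x Hx sQxY] := Hall_Jsub solH hallY sQH (pHall_pgroup hallQ).
have [nnilS _] := schS.
have defSx : (P :&: S) :^ x * Q :^ x = S :^ x by rewrite -conjsMg defS.
have sP2P : (P :&: S) :^ x \subset P.
  have nPx : x \in 'N(P) by apply: subsetP Hx; rewrite normal_norm.
  by have := conjSg (P :&: S) P x; rewrite (normP nPx) subsetIl.
have nnilSx : ~~ nilpotent (S :^ x).
  by rewrite -(isog_nil (conj_isog S x)).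
have nP2Q : Q :^ x \subset 'N((P :&: S) :^ x).
  by rewrite normJ conjSg (subset_trans (pHall_sub hallQ)) // normal_norm.
have [defQx | sQxYq] := pgroup_cycle_sub_or_eq qy sQxY; last first.
  case/negP: nnilSx; rewrite -defSx mulg_nil; last first.
    rewrite (subset_trans sQxYq) // cycle_subG.
    by apply: subsetP CPyq; apply: centS.
  rewrite (pgroup_nil (pgroupS sP2P pP)).
  by rewrite (pgroup_nil (pgroupS sQxY qy)).
exists ((P :&: S) :^ x)%G.
have nP2y : y \in 'N((P :&: S) :^ x) by rewrite -cycle_subG -defQx.
split=> //.
  apply: contra nnilSx => CP2y.
  rewrite -defSx defQx mulg_nil ?cycle_subG //.
  by rewrite (pgroup_nil (pgroupS sP2P pP)) abelian_nil ?cycle_abelian.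
have modSx := modularJ (modG S (subset_trans sSH sHG) schS) (subsetP sHG x Hx).
have -> //: ((P :&: S) :^ x <*> <[y]>)%G = (S :^ x)%G.
by apply: val_inj; rewrite /= -defSx defQx norm_joinEr ?cycle_subG.
Qed.

Lemma schmidt_coprime_modular (gT : finGroupType) (G : {group gT}) :
    (forall S : {group gT}, S \subset G -> schmidt_group S ->
       modular_subgroup G S) ->
  coprime_modular G.
Proof.
move=> modG p q P y neq_pq pP qy sPG Gy nPy nCPy CPyq.
have [P0 [sP0P nP0y _ modP0]] :=
  schmidt_coprime modG neq_pq pP qy sPG Gy nPy nCPy CPyq.
by exists P0.
Qed.

(** [R] is a Sylow subgroup of the preimage of [Rb], and the Frattini argument
    finds an element above [yb] that normalises it. *)
Lemma lift_coprime_action (gT : finGroupType) (G N : {group gT})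
    (Rb : {group coset_of N}) (yb : coset_of N) (r t : nat) :
    N <| G -> Rb \subset G / N -> r.-group Rb -> yb \in G / N -> t.-elt yb ->
    yb \in 'N(Rb) ->
  exists (R : {group gT}) (y : gT),
    [/\ r.-group R /\ R \subset G, R / N = Rb, y \in 'N_G(R), t.-elt y
      & coset N y = yb].
Proof.
move=> nsNG sRbG rRb Gyb tyb nRyb.
have [K defK sNK sKG] := inv_quotientS nsNG sRbG.
have [R sylR] := Sylow_exists r K; have [sRK rR _] := and3P sylR.
have nNK : K \subset 'N(N) := subset_trans sKG (normal_norm nsNG).
have nNR := subset_trans sRK nNK.
have defRb : R / N = Rb.
  have := quotient_pHall nNR sylR; rewrite -defK => /pHall_id; exact.
have [y0 nNy0 Gy0 def_yb] := morphimP Gyb; rewrite /= in def_yb.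
have nKy0 : y0 \in 'N(K).
  apply/normP; apply: (@quotient_inj _ N (K :^ y0) K).
  - rewrite /normal -{1}(normP nNy0) conjSg sNK /=.
    by rewrite -(normP nNy0) normJ conjSg.
  - exact: normalS sNK sKG nsNG.
  by rewrite quotientJ // -defK -def_yb; apply/normP.
pose L := 'N_G(K)%G; have sKL : K \subset L by rewrite subsetI sKG normG.
have nsKL : K <| L by rewrite /normal sKL subsetIr.
have defK' : N * R = K.
  by rewrite -(quotientK nNR) defRb defK quotientGK // (normalS sNK sKG).
have [n Nn Ry1] : exists2 n, n \in N & n * y0 \in 'N_L(R).
  have : y0 \in K * 'N_L(R) by rewrite (Frattini_arg nsKL sylR) inE Gy0.
  rewrite -defK' -mulgA mulSGid; last by rewrite subsetI normG (subset_trans sRK).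
  case/mulsgP=> n z Nn Rz ->; exists n^-1; rewrite ?groupV // mulKg //.
have{Ry1} Ry1 : n * y0 \in 'N_G(R).
  by apply: subsetP Ry1; rewrite setSI ?subsetIl.
have nNn : n \in 'N(N) by rewrite (subsetP (normG N)).
exists R, (n * y0).`_t; split; rewrite ?p_elt_constt //.
- by rewrite (subset_trans sRK).
- by apply: subsetP (mem_cycle _ _); rewrite cycle_subG.
rewrite morph_constt ?groupM //= morphM //= (coset_id Nn) mul1g -def_yb.
exact: constt_p_elt.
Qed.

(** The witness is the centraliser of [y ^+ t] in [R]: by coprime action it has the
    same image as [R] modulo [N]. *)
Lemma lift_coprime_cent (gT : finGroupType) (N R : {group gT}) (y : gT)
    (r t : nat) :
    r != t -> r.-group R -> R \subset 'N(N) -> y \in 'N(N) -> y \in 'N(R) ->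
    t.-elt y -> coset N y \notin 'C(R / N) -> coset N y ^+ t \in 'C(R / N) ->
  exists R1 : {group gT},
    [/\ R1 \subset R, y \in 'N(R1), y \notin 'C(R1) & y ^+ t \in 'C(R1)].
Proof.
move=> neq_rt rR nNR nNy nRy ty nCy Cyt; set z := y ^+ t.
have nRZ : <[z]> \subset 'N(R) by rewrite cycle_subG groupX.
have nNZ : <[z]> \subset 'N(N) by rewrite cycle_subG groupX.
have coRZ : coprime #|R| #|<[z]>|.
  by apply: coprime_pgroups neq_rt rR _; apply: p_eltX.
have nsRN : R :&: N <| R by rewrite /normal subsetIl normsI ?normG.
have defR : (R :&: N) * 'C_R(<[z]>) = R.
  apply: coprime_mul_cent; rewrite ?(pgroup_sol rR) ?normsI //.
  rewrite subsetI commg_subl nRZ -quotient_cents2 // centsC.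
  by rewrite quotient_cycle ?groupX // cycle_subG morphX.
exists 'C_R(<[z]>)%G; split; first exact: subsetIl.
- have Czy : y \in 'C(<[z]>).
    by rewrite cent_cycle; apply/cent1P/commuteX/commute_refl.
  rewrite -cycle_subG normsI ?norms_cent ?cycle_subG //.
  exact: subsetP (cent_sub _) _ Czy.
- apply: contra nCy => C1y.
  rewrite -defR quotientMl ?subIset ?nNR // quotientS1 ?subsetIr // mul1g.
  by rewrite -cycle_subG -quotient_cycle // quotient_cents ?cycle_subG.
by rewrite -cycle_subG centsC subsetIr.
Qed.

Lemma coprime_modular_quotient (gT : finGroupType) (G N : {group gT}) :
  N <| G -> coprime_modular G -> coprime_modular (G / N).
Proof.
move=> nsNG modG p q Pb yb neq_pq pPb qyb sPbG Gyb nPyb nCyb Cybq.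
have [P [y [[pP sPG] defP /setIP[Gy nPy] qy def_yb]]] :=
  lift_coprime_action nsNG sPbG pPb Gyb qyb nPyb.
have nNG := normal_norm nsNG.
have nNy : y \in 'N(N) by rewrite (subsetP nNG).
have nNP := subset_trans sPG nNG.
rewrite -defP -def_yb in nCyb Cybq.
have [P1 [sP1P nP1y nCP1y CP1yq]] :=
  lift_coprime_cent neq_pq pP nNP nNy nPy qy nCyb Cybq.
have [P0 [sP01 nP0y modP0]] := modG p q P1 y neq_pq (pgroupS sP1P pP) qy
  (subset_trans sP1P sPG) Gy nP1y nCP1y CP1yq.
have sP0P := subset_trans sP01 sP1P.
exists (P0 / N)%G; split.
- by rewrite -defP quotientS.
- rewrite -def_yb -cycle_subG -quotient_cycle // quotient_norms //.
  by rewrite cycle_subG.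
have -> : (P0 / N <*> <[yb]>)%G = ((P0 <*> <[y]>) / N)%G.
  apply: val_inj; rewrite /= quotientY ?cycle_subG ?(subset_trans sP0P) //.
  by rewrite quotient_cycle // def_yb.
exact: modular_quotient.
Qed.

(** * Soluble groups: nilpotent modulo the Fitting subgroup *)

Section NilpotentQuotients.

Variable gT : finGroupType.
Implicit Types G H K L N R : {group gT}.

Lemma nilpotent_quotientP G N :
  G \subset 'N(N) -> reflect (exists n, 'L_n.+1(G) \subset N) (nilpotent (G / N)).
Proof.
move=> nNG; apply: (iffP (lcnP _)) => [[n Ln1] | [n sLnN]]; exists n.
  rewrite -quotient_sub1 ?(subset_trans (lcn_sub _ _)) //.
  by rewrite /quotient morphim_lcn // -/(quotient _ _) Ln1.
by rewrite -morphim_lcn // -/(quotient _ _) quotientS1.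
Qed.

Lemma nilpotent_quotientI G H K :
    G \subset 'N(H) -> G \subset 'N(K) ->
    nilpotent (G / H) -> nilpotent (G / K) ->
  nilpotent (G / (H :&: K)).
Proof.
move=> nHG nKG /(nilpotent_quotientP nHG)[m sLH] /(nilpotent_quotientP nKG)[n sLK].
apply/(nilpotent_quotientP (N := (H :&: K)%G)); first by rewrite normsI.
exists (maxn m n); rewrite subsetI.
rewrite (subset_trans _ sLH) ?(subset_trans _ sLK) ?lcn_sub_leq //.
  by rewrite ltnS leq_maxr.
by rewrite ltnS leq_maxl.
Qed.

Lemma nilpotent_quotientS G H K :
    H \subset K -> G \subset 'N(H) -> G \subset 'N(K) ->
  nilpotent (G / H) -> nilpotent (G / K).
Proof.
move=> sHK nHG nKG /(nilpotent_quotientP nHG)[n sLH].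
by apply/(nilpotent_quotientP nKG); exists n; apply: subset_trans sHK.
Qed.

Lemma nilpotent_central_ext G H :
  H \subset 'Z(G) -> nilpotent (G / H) -> nilpotent G.
Proof.
move=> sHZ; have nHG : G \subset 'N(H).
  by rewrite cents_norm // centsC (subset_trans sHZ) // subsetIr.
rewrite -quotient_center_nil; apply: nilpotent_quotientS => //.
exact: gFnorm.
Qed.

Lemma Fitting_mul_Sylow (G T : {group gT}) (t : nat) :
  t.-Sylow(G) T -> 'F(G) * T = 'O_t^'('F(G)) * T.
Proof.
move=> sylT.
have [_ defF cOW _] := dprodP (nilpotent_pcoreC t (Fitting_nil G)).
have sOT : 'O_t('F(G)) \subset T.
  rewrite (subset_trans _ (pcore_sub_Hall sylT)) // pcore_max ?pcore_pgroup //.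
  exact: gFnormal_trans (Fitting_normal G).
by rewrite -{1}defF -(centC cOW) -mulgA (mulSGid sOT).
Qed.

Lemma Fitting_joing_Sylow_normal (G T : {group gT}) (t : nat) :
  nilpotent (G / 'F(G)) -> t.-Sylow(G) T -> 'F(G) <*> T <| G.
Proof.
move=> nilGF sylT.
have nFT : T \subset 'N('F(G)) := subset_trans (pHall_sub sylT) (gFnorm _ _).
rewrite norm_joinEr // -(quotientK nFT).
rewrite -[X in _ <| X](quotientGK (Fitting_normal G)) cosetpre_normal.
rewrite (nilpotent_Hall_pcore nilGF (quotient_pHall nFT sylT)).
exact: pcore_normal.
Qed.

(** Some Sylow t-subgroup [T] is not in ['F(G)].  If it centralised the t'-part [W]
    of ['F(G)], then [T] would be characteristic in the normal subgroup
    ['F(G) <*> T = W * T], hence normal in [G].  So an element of [T] moves some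
    Sylow subgroup of [W]. *)
Lemma nilpotent_by_nilpotent_action G :
    nilpotent (G / 'F(G)) -> ~~ nilpotent G ->
  exists (r t : nat) (R : {group gT}) (y : gT),
    [/\ r != t, r.-group R, R <| G & [/\ t.-elt y, y \in G & y \notin 'C(R)]].
Proof.
move=> nilGF nnilG; have nFG : G \subset 'N('F(G)) := gFnorm _ _.
have [T [t pr_t sylT] nsTF] : exists2 T : {group gT},
    exists2 t, prime t & t.-Sylow(G) T & ~~ (T \subset 'F(G)).
  have : ~~ (G \subset 'F(G)).
    by apply: contra nnilG => sGF; apply: nilpotentS sGF (Fitting_nil G).
  rewrite -{1}(Sylow_gen G) gen_subG.
  case/subsetPn=> x /bigcupP[T /SylowP sylT Tx] nFx; exists T => //.
  by apply: contra nFx => /subsetP; apply.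
have [sTG tT _] := and3P sylT.
pose W := 'O_t^'('F(G))%G; have charW : W \char G.
  by apply: char_trans (pcore_char _ _) (Fitting_char _).
have nilW : nilpotent W := nilpotentS (pcore_sub _ _) (Fitting_nil G).
have nsWG := char_normal charW.
have nCWT : ~~ (T \subset 'C(W)).
  apply: contra nsTF => cWT; apply: Fitting_max (pgroup_nil tT).
  have nsFTY := Fitting_joing_Sylow_normal nilGF sylT.
  have sTFT : T \subset 'F(G) <*> T := joing_subr _ _.
  have defFTY : 'F(G) <*> T = W * T.
    by rewrite norm_joinEr ?(subset_trans sTG) // (Fitting_mul_Sylow sylT).
  have nsT : T <| 'F(G) <*> T.
    rewrite /normal sTFT defFTY mul_subG ?normG // cents_norm // centsC //.
  have hallT := pHall_subl sTFT (normal_sub nsFTY) sylT.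
  rewrite -(normal_Hall_pcore hallT nsT).
  exact: gFnormal_trans nsFTY.
have [y Ty nCWy] := subsetPn nCWT.
have [R [r pr_r sylR] nCRy] : exists2 R : {group gT},
    exists2 r, prime r & r.-Sylow(W) R & y \notin 'C(R).
  have : ~~ (W \subset 'C[y]) by rewrite -cent_cycle centsC cycle_subG.
  rewrite -{1}(Sylow_gen W) gen_subG.
  case/subsetPn=> x /bigcupP[R /SylowP sylR Rx] nCyx; exists R => //.
  apply: contra nCyx => CRy; apply/cent1P/commute_sym.
  exact: (centP CRy).
have defR := nilpotent_Hall_pcore nilW sylR.
exists r, t, R, y; split.
- apply: contraNneq nCRy => eq_rt.
  have -> : R :=: 1; last by rewrite cent1T inE.
  apply/eqP; rewrite -subG1 -(coprime_TIg (G := R) (H := R)) ?subsetIidl ?setIid //.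
  apply: pnat_coprime (pHall_pgroup sylR) _; rewrite eq_rt.
  exact: pgroupS (pHall_sub sylR) (pcore_pgroup _ _).
- exact: pHall_pgroup sylR.
- by rewrite defR gFnormal_trans.
split=> //; last by rewrite (subsetP sTG).
exact: mem_p_elt tT Ty.
Qed.

End NilpotentQuotients.

(** The preimage of ['F(G / N)] and the centraliser of [N] have nilpotent quotients,
    hence so has their intersection, which is a central extension by [N] of
    a nilpotent group. *)
Lemma nilpotent_quo_Fitting_cent (gT : finGroupType) (G N : {group gT}) :
    N <| G -> abelian N -> nilpotent (G / N / 'F(G / N)) ->
    nilpotent (G / 'C_G(N)) ->
  nilpotent (G / 'F(G)).
Proof.
move=> nsNG abN nilGN nilGC; have nNG := normal_norm nsNG.
have [L defL sNL nsLG] := inv_quotientN nsNG (Fitting_normal (G / N)).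
have nCG : G \subset 'N('C_G(N)) by rewrite normsI ?normG ?norms_cent.
have nLG := normal_norm nsLG.
have nilGL : nilpotent (G / L).
  by rewrite -(isog_nil (third_isog sNL nsNG nsLG)) -defL.
have nilGK : nilpotent (G / (L :&: 'C_G(N))).
  exact: (nilpotent_quotientI (H := L) (K := 'C_G(N))).
have nsKG : L :&: 'C_G(N) <| G.
  by rewrite /normal (normsI nLG nCG) subIset // normal_sub.
apply: nilpotent_quotientS (normal_norm nsKG) (gFnorm _ _) nilGK.
apply: Fitting_max nsKG _.
apply: (nilpotent_central_ext (H := N)).
  rewrite subsetI !subsetI sNL (normal_sub nsNG) /=.
  by rewrite -/(abelian N) abN centsC !subIset ?subxx ?orbT.
apply: nilpotentS (Fitting_nil (G / N)).
by rewrite defL quotientS // subsetIl.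
Qed.

(** Induction on the order.  With [N] minimal normal and [C] its centraliser, only
    a non-nilpotent [G / C] needs care.  There a t-element acts nontrivially on
    a normal r-subgroup; this action is lifted to [R] and [y] with [y] in
    ['N(R)].  As ['C_N(R) = 1], the modular subgroup found in ['N(R)] meets [N]
    trivially and normalises all subgroups of [N]. *)
Theorem coprime_modular_metanilpotent (gT : finGroupType) (G : {group gT}) :
  solvable G -> coprime_modular G -> nilpotent (G / 'F(G)).
Proof.
have [n] := ubnP #|G|; elim: n => // n IHn in gT G * => /ltnSE-leGn solG modG.
have [-> | ntG] := eqsVneq G 1.
  by rewrite quotient_nil ?nilpotent1.
have [N minN sNG] := minnormal_exists ntG (normG G).
have [/andP[ntN nNG] _] := mingroupP minN.
have nsNG : N <| G by apply/andP.
have [_ _ /is_abelemP[p pr_p abelN]] := minnormal_solvable minN sNG solG.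
have abN := abelem_abelian abelN; have pN := abelem_pgroup abelN.
pose C := 'C_G(N)%G; have sNC : N \subset C by rewrite subsetI sNG.
have nsCG : C <| G.
  by rewrite /normal subsetIl normsI ?normG ?norms_cent.
have IHq (K : {group gT}) : K <| G -> K :!=: 1 ->
    nilpotent (G / K / 'F(G / K)).
  move=> nsKG ntK; apply: IHn.
  - by apply: leq_trans leGn; rewrite ltn_quotient ?normal_sub.
  - exact: quotient_sol.
  - exact: coprime_modular_quotient.
have [nilGC | nnilGC] := boolP (nilpotent (G / C)).
  exact: (nilpotent_quo_Fitting_cent nsNG abN (IHq N nsNG ntN) nilGC).
have ntC : C :!=: 1 by apply: contraNneq ntN => C1; rewrite -subG1 -C1.
have [r [t [Rb [yb [neq_rt rRb nsRb [tyb Gyb nCyb]]]]]] :=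
  nilpotent_by_nilpotent_action (IHq C nsCG ntC) nnilGC.
have {tyb Gyb nCyb yb} [yb [tyb Gyb nCyb Cybt]] : exists yb : coset_of C,
    [/\ t.-elt yb, yb \in G / C, yb \notin 'C(Rb) & yb ^+ t \in 'C(Rb)].
  have [k [nCyk Cyk]] := min_power_notin tyb nCyb.
  exists (yb ^+ (t ^ k)%N); split; rewrite ?p_eltX //; first exact: groupX.
  by rewrite -expgM -expnSr.
have nRyb : yb \in 'N(Rb) by apply: subsetP Gyb; apply: normal_norm.
have [R [y [[rR sRG] defRb /setIP[Gy nRy] ty def_yb]]] :=
  lift_coprime_action nsCG (normal_sub nsRb) rRb Gyb tyb nRyb.
have nCG := normal_norm nsCG; have nCR := subset_trans sRG nCG.
have [K defK sCK nsKG] := inv_quotientN nsCG nsRb.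
have defCR : C * R = K.
  by rewrite -(quotientK nCR) defRb defK quotientGK // (normalS sCK _ nsCG) ?normal_sub.
have cNC : C \subset 'C(N) by rewrite subsetIr.
have defCNK : 'C_N(K) = 'C_N(R).
  have sNCC : N \subset 'C(C) by rewrite centsC.
  by rewrite -defCR centM setIA (setIidPl sNCC).
have tiCNR : 'C_N(R) = 1.
  rewrite -defCNK; apply: contraNeq nCyb => ntCNK.
  have defN : 'C_N(K) = N.
    have [_ minN'] := mingroupP minN.
    apply: (minN' 'C_N(K)%G); last exact: subsetIl.
    by rewrite ntCNK normsI ?norms_cent // normal_norm.
  have sKC : K \subset C.
    by rewrite subsetI normal_sub //= centsC -defN subsetIr.
  by rewrite defK quotientS1 // cent1T inE.
(* Otherwise [R] would be a p-group and fix a nontrivial element of [N]. *)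
have neq_rp : r != p.
  apply: contra_eqN tiCNR => /eqP eq_rp.
  have pNR : p.-group (N <*> R).
    rewrite norm_joinEr ?(subset_trans sRG) // pgroupM pN -eq_rp //.
  have nsN : N <| N <*> R.
    by rewrite /normal joing_subl join_subG normG (subset_trans sRG).
  apply: subG1_contra (meet_center_nil (pgroup_nil pNR) nsN ntN).
  by rewrite setIS // subIset // centS ?orbT // joing_subr.
have [R1 [sR1R nR1y nCR1y CR1yt]] : exists R1 : {group gT},
    [/\ R1 \subset R, y \in 'N(R1), y \notin 'C(R1) & y ^+ t \in 'C(R1)].
  apply: (lift_coprime_cent (N := C) neq_rt rR nCR) => //.
  - by rewrite (subsetP nCG).
  - by rewrite defRb def_yb.
  - by rewrite defRb def_yb.
have [P0 [sP0R1 nP0y modM]] := modG r t R1 y neq_rt (pgroupS sR1R rR) ty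
  (subset_trans sR1R sRG) Gy nR1y nCR1y CR1yt.
set M := (P0 <*> <[y]>)%G in modM.
have sMNR : M \subset 'N(R).
  rewrite join_subG cycle_subG nRy andbT.
  by rewrite (subset_trans sP0R1) ?(subset_trans sR1R) ?normG.
have tiMN : M :&: N = 1.
  apply/trivgP; rewrite -tiCNR subsetI subsetIr /=.
  have coNR : coprime #|N| #|R| by rewrite coprime_sym (coprime_pgroups neq_rp).
  apply/commG1P/trivgP; rewrite -(coprime_TIg coNR) commg_subI //.
    by rewrite subsetI subsetIr subIset ?sMNR.
  by rewrite subsetI subxx (subset_trans sRG).
have nXy x : x \in N -> y \in 'N(<[x]>).
  move=> Nx; rewrite -cycle_subG (subset_trans (joing_subr P0 _)) //.
  by rewrite (modular_norm_TI modM nsNG) ?cycle_subG.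
have nXyg g x : g \in G -> x \in N -> y ^ g \in 'N(<[x]>).
  move=> Gg Nx; have Nxg : x ^ g^-1 \in N by rewrite memJ_norm // groupV (subsetP nNG).
  by rewrite -(conjgKV g x) cycleJ normJ memJ_conjg nXy.
(* [y] and its conjugates act as power automorphisms of [N]. *)
have Cyyg g : g \in G -> [~ y, y ^ g] \in C.
  move=> Gg; rewrite inE groupR ?groupJ //=; apply/centP=> x Nx.
  by apply/cent1P; rewrite cyclic_norm_commg ?nXy ?nXyg.
have cyyg gb : gb \in Rb -> yb ^ gb \in 'C[yb].
  rewrite -defRb => /morphimP[g nCg Rg ->]; have Gg := subsetP sRG g Rg.
  have nCy := subsetP nCG y Gy.
  apply/cent1P/commgP; rewrite -def_yb -morphJ //= -morphR ?groupJ //.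
  by apply/eqP/coset_id; rewrite -groupV invg_comm; apply: Cyyg.
case/negP: nCyb; rewrite -cycle_subG; apply: coprime_cent_commg.
- by rewrite cycle_subG.
- exact: coprime_pgroups neq_rt rRb tyb.
- exact: pgroup_sol rRb.
rewrite cent_gen centsC cent_cycle.
apply/subsetP=> _ /imset2P[gb _ Rgb /cycleP[i ->] ->].
rewrite commgEr groupM ?groupX ?cent1id // conjVg conjXg groupV groupX //.
exact: cyyg.
Qed.

(** * Solubility *)

(** [R] and [R :^ x] are Sylow subgroups of the centraliser of [g ^ x], hence
    conjugate there, so that [g] and [g ^ x] are already conjugate under
    ['N_G(R)]. *)
Lemma central_Sylow_fusion (gT : finGroupType) (G R : {group gT}) (p : nat) (g x : gT) :
    p.-Sylow(G) R -> 'N_G(R) \subset 'C(R) -> x \in G ->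
  g \in R -> g ^ x \in R -> g ^ x = g.
Proof.
move=> sylR cRN Gx Rg Rgx; have [sRG pR _] := and3P sylR.
have abR : abelian R by apply: subset_trans cRN; rewrite subsetI sRG normG.
have sylRc (S : {group gT}) :
  p.-Sylow(G) S -> S \subset 'C[g ^ x] -> p.-Sylow('C_G[g ^ x]) S.
  move=> sylS cS; apply: (pHall_subl _ _ sylS); last exact: subsetIl.
  by rewrite subsetI cS (pHall_sub sylS).
have sylR1 : p.-Sylow('C_G[g ^ x]) R.
  by rewrite sylRc // -cent_cycle centsC cycle_subG (subsetP abR).
have sylR2 : p.-Sylow('C_G[g ^ x]) (R :^ x).
  rewrite sylRc ?pHallJ // -cent_cycle cycleJ centJ conjSg centsC cycle_subG.
  exact: subsetP abR g Rg.
have [c /setIP[Gc /cent1P cgc] defR] := Sylow_trans sylR2 sylR1.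
have : g ^ (x * c) = g.
  apply/conjg_fixP/commgP/commute_sym.
  apply: (centP (subsetP cRN (x * c) _)) => //.
  by rewrite inE groupM //=; apply/normP; rewrite conjsgM -defR.
by rewrite conjgM => gxc; rewrite -[RHS]gxc [RHS]conjgE -cgc mulKg.
Qed.

Section Transfer.

Import GRing.Theory FiniteModule.

(** The transfer of [G] into [R] kills the derived subgroup, and by
    central_Sylow_fusion it raises the elements of [R] to the power [#|G : R|],
    which is prime to p. *)
Lemma Burnside_transfer (gT : finGroupType) (G R : {group gT}) (p : nat) :
  p.-Sylow(G) R -> 'N_G(R) \subset 'C(R) -> R :&: G^`(1) = 1.
Proof.
move=> sylR cRN; have [sRG pR p'GR] := and3P sylR.
have abR : abelian R by apply: subset_trans cRN; rewrite subsetI sRG normG.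
have abA : abelian (idm R @* R) by rewrite morphim_idm.
have imR h : h \in R -> h \in (idm R @* R)%G by rewrite /= morphim_idm.
apply/trivgP/subsetP=> g /setIP[Rg G'g]; have Gg := subsetP sRG g Rg.
pose f := transfer_morphism G abA.
have kerG' : G^`(1) \subset 'ker f.
  rewrite -sub_morphim_pre ?der_sub // morphim_der //.
  by apply/trivgP/derG1P; apply: FinRing.zmod_abelian.
have fg0 : transfer G abA g = 0%R.
  by have /kerP := subsetP kerG' g G'g; apply; rewrite // (subsetP (der_sub 1 G)).
have [X trX] : exists X : {set gT}, is_transversal X (rcosets R G :* <[g]>) G.
  exists (transversal (rcosets R G :* <[g]>) G).
  exact/transversalP/rcosets_cycle_partition.
have fgX := transfer_cycle_expansion sRG abA Gg trX.
have sXG x : x \in X -> x \in G by apply/subsetP/(transversal_sub trX).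
have Rterm x : x \in X -> (g ^+ #|<[g]> : R :* x|) ^ x^-1 = g ^+ #|<[g]> : R :* x|.
  move=> Xx; apply: (central_Sylow_fusion sylR cRN); rewrite ?groupV ?sXG ?groupX //.
  rewrite conjgE invgK mulgA -mem_rcoset.
  exact: mulg_exp_card_rcosets.
rewrite fg0 (eq_bigr (fun x => fmod abA g *+ #|<[g]> : R :* x|)%R) in fgX; last first.
  by move=> x Xx; rewrite /= Rterm // /restrm /= fmodX ?imR.
have : fmod abA (g ^+ #|G : R|) = 0%R.
  rewrite fmodX ?imR // -(sum_index_rcosets_cycle sRG Gg trX).
  by rewrite -GRing.sumrMnr; apply: esym.
move/(congr1 val); rewrite /= fmodK ?imR ?groupX // => /eqP.
rewrite -order_dvdn => dvd_g_GR; rewrite inE -order_eq1 -dvdn1.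
have /eqP <- : coprime #[g] #|G : R| by apply: pnat_coprime p'GR; apply: mem_p_elt Rg.
by rewrite dvdn_gcd dvdnn.
Qed.

End Transfer.

Lemma abelian_normal_TI_maximal (gT : finGroupType) (X E V : {group gT}) :
    maximal E X -> gcore E X = 1 -> abelian V -> V <| X -> V :!=: 1 ->
  [/\ V * E = X, V :&: E = 1 & 'C_X(V) = V].
Proof.
move=> maxE core1 abV nsVX ntV; have [sVX nVX] := andP nsVX.
have [/andP[sEX _] maxE'] := maxgroupP maxE.
have core_triv (K : {group gT}) : K <| X -> K \subset E -> K :=: 1.
  case/andP=> sKX nKX sKE; apply/trivgP; rewrite -core1.
  exact: gcore_max.
have defX : V * E = X.
  have nVE := subset_trans sEX nVX.
  apply: contraNeq ntV; rewrite -norm_joinEr // => neqX.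
  rewrite (core_triv V) // -(maxE' (V <*> E)%G) ?joing_subl ?joing_subr //.
  by rewrite properEneq neqX join_subG sVX.
split=> //.
  apply: (core_triv (V :&: E)%G); last exact: subsetIr.
  rewrite /normal subIset ?sVX //= -{1}defX mul_subG //.
    by rewrite cents_norm // (subset_trans abV) // centS ?subsetIl.
  by rewrite normsI ?normG // (subset_trans sEX).
have CE1 : 'C_E(V) = 1.
  apply: (core_triv 'C_E(V)%G); last exact: subsetIl.
  rewrite /normal subIset ?sEX //= -{1}defX mul_subG //.
    by rewrite cents_norm // centsC subsetIr.
  by rewrite normsI ?normG ?norms_cent // (subset_trans sEX).
by rewrite -defX -group_modl // CE1 mulg1.
Qed.

(** A minimal normal subgroup [V] of [X] is a self-centralising complement of [E].
    By modularity [E] normalises every subgroup of [V], so [V] has prime order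
    [a] and [E] embeds in its automorphism group, of order [a.-1].  Unless
    [E = 1] this gives [q < a], and then the q-group [R] avoids [V], hence
    centralises it. *)
Lemma corefree_maximal_modular_central (gT : finGroupType) (X E R : {group gT})
    (q : nat) :
    solvable X -> maximal E X -> modular_subgroup X E -> gcore E X = 1 ->
    (forall b, prime b -> b %| #|X| -> q <= b) -> q.-group R -> R <| X ->
  R \subset 'C(X).
Proof.
move=> solX maxE modE core1 minq qR nsRX; have [sRX nRX] := andP nsRX.
have ntX : X :!=: 1.
  have [/proper_card ltEX _] := maxgroupP maxE.
  by rewrite -cardG_gt1 (leq_ltn_trans (cardG_gt0 E)).
have [V minV sVX] := minnormal_exists ntX (normG X).
have [/andP[ntV nVX] minV'] := mingroupP minV.
have [_ _ /is_abelemP[a pr_a abelV]] := minnormal_solvable minV sVX solX.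
have abV := abelem_abelian abelV; have nsVX : V <| X by apply/andP.
have [defX tiVE defCV] := abelian_normal_TI_maximal maxE core1 abV nsVX ntV.
have sEX := maxgroupp maxE; have {sEX} sEX := proper_sub sEX.
have [v Vv ntv] := trivgPn _ ntV.
have defV : <[v]> = V.
  apply: (minV' <[v]>%G); last by rewrite cycle_subG.
  rewrite cycle_eq1 ntv -defX mul_subG //.
    by rewrite cents_norm // (subset_trans abV) // centS ?cycle_subG.
  apply: (modular_norm_TI modE nsVX); last by rewrite cycle_subG.
  by rewrite setIC.
have oV : #|V| = a by rewrite -defV -orderE (abelem_order_p abelV).
have [E1 | ntE] := eqVneq (E : {set gT}) 1.
  by rewrite -defX E1 mulg1 (subset_trans sRX) // -defX E1 mulg1.
have lt_qa : q < a.
  have injE : 'injm (restrm (subset_trans sEX nVX) (conj_aut V)).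
    have sCV : 'C_E(V) \subset V by rewrite -{2}defCV setSI.
    apply/subsetP=> e; rewrite ker_restrm ker_conj_aut => /= Ce.
    by rewrite -tiVE inE (subsetP sCV) //; case/setIP: Ce.
  have le_Ea : #|E| <= a.-1.
    rewrite -(card_injm injE) // morphim_restrm setIid.
    rewrite -(totient_prime pr_a) -oV -card_Aut_cyclic -?defV ?cycle_cyclic //.
    by rewrite subset_leq_card ?Aut_conj_aut.
  have [b pr_b b_E] : exists2 b, prime b & b %| #|E|.
    by exists (pdiv #|E|); rewrite ?pdiv_prime ?pdiv_dvd // cardG_gt1.
  apply: leq_ltn_trans (minq b pr_b (dvdn_trans b_E (cardSg sEX))) _.
  by rewrite -(ltn_predK (prime_gt1 pr_a)) ltnS (leq_trans (dvdn_leq _ b_E)).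
have coRV : coprime #|R| #|V|.
  apply: (@coprime_pgroups _ q a) => //; first by rewrite ltn_eqF.
  exact: abelem_pgroup abelV.
have tiRV := coprime_TIg coRV.
have cRV : R \subset 'C(V).
  apply/commG1P/trivgP; rewrite -tiRV commg_subI //.
    by rewrite subsetI subxx (subset_trans sRX).
  by rewrite subsetI subxx (subset_trans sVX).
have sRV : R \subset V by rewrite -defCV subsetI sRX.
by rewrite -(setIidPl sRV) tiRV sub1G.
Qed.

Lemma maximal_modular_comm (gT : finGroupType) (X E R : {group gT}) (q : nat) :
    solvable X -> maximal E X -> modular_subgroup X E ->
    (forall b, prime b -> b %| #|X| -> q <= b) -> q.-group R -> R <| X ->
  [~: R, X] \subset E.
Proof.
move=> solX maxE modE minq qR nsRX.
have sEX := proper_sub (maxgroupp maxE).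
pose D := gcore_group E X; have nsDX : D <| X by apply: gcore_normal.
have nDX := normal_norm nsDX; have sDE : D \subset E := gcore_sub E X.
have sRX := normal_sub nsRX.
apply: (subset_trans _ sDE); rewrite -quotient_cents2 ?(subset_trans sRX) //.
have nsDE : D <| E := normalS sDE sEX nsDX.
apply: (@corefree_maximal_modular_central _ (X / D)%G (E / D)%G (R / D)%G q).
- exact: quotient_sol.
- by rewrite quotient_maximal.
- exact: modular_quotient.
- pose K := gcore_group (E / D)%G (X / D)%G; apply/trivgP; suffices: K \subset [1] by [].
  have nsK : K <| X / D by apply: gcore_normal; rewrite quotientS.
  have [L defL sDL nsLX] := inv_quotientN nsDX nsK.
  have nDL := subset_trans (normal_sub nsLX) nDX.
  rewrite defL quotient_sub1 //; apply: gcore_max _ (normal_norm nsLX).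
  by rewrite -(quotientSGK nDL sDE) -defL gcore_sub.
- move=> b pr_b b_XD; apply: minq => //; apply: dvdn_trans b_XD _.
  exact: dvdn_quotient.
- exact: quotient_pgroup.
exact: quotient_normal.
Qed.

Lemma simple_norm_proper (gT : finGroupType) (G H : {group gT}) :
  simple G -> H \proper G -> H :!=: 1 -> 'N_G(H) \proper G.
Proof.
case/simpleP=> _ simG prHG ntH; rewrite properEneq subsetIl andbT.
apply: contraNneq ntH => defN; case: (simG H) => [|-> //|defH].
  by rewrite /normal (proper_sub prHG) -{1}defN subsetIr.
by rewrite defH properxx in prHG.
Qed.

Lemma trivial_maximal_solvable (gT : finGroupType) (G M : {group gT}) :
  maximal M G -> M :=: 1 -> solvable G.
Proof.
move=> maxM M1; have [prMG maxM'] := maxgroupP maxM.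
have [_ [x Gx nMx]] := properP prMG.
have [prx | ] := boolP (<[x]> \proper G).
  case/negP: nMx; rewrite -cycle_subG -(maxM' <[x]>%G) //.
  by rewrite M1 sub1G.
rewrite properEneq cycle_subG Gx andbT negbK => /eqP <-.
by rewrite abelian_sol ?cycle_abelian.
Qed.

(** Take two maximal subgroups with the largest possible nontrivial intersection
    [D].  In both of them [D] grows in its normaliser, and ['N_G(D)] lies in
    a maximal subgroup, which must then be equal to each of the two. *)
Lemma proper_nilpotent_maximal_TI (gT : finGroupType) (G M1 M2 : {group gT}) :
    simple G -> (forall H : {group gT}, H \proper G -> nilpotent H) ->
    maximal M1 G -> maximal M2 G -> M1 != M2 ->
  M1 :&: M2 = 1.
Proof.
move=> simG nilG; have [n] := ubnP (#|G| - #|M1 :&: M2|)%N.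
elim: n => // n IHn in M1 M2 * => /ltnSE-leDn max1 max2 neq12.
pose D := (M1 :&: M2)%G; apply/eqP/idPn => ntD.
have [pr1 pr2] := (maxgroupp max1, maxgroupp max2).
have not_sub (A B : {group gT}) :
  maximal A G -> maximal B G -> A != B -> ~~ (A \subset B).
  move=> maxA maxB; apply: contra => sAB; have [_ maxA'] := maxgroupP maxA.
  by apply/eqP/val_inj; rewrite /= (maxA' B) // (maxgroupp maxB).
have prD1 : D \proper M1.
  by rewrite properE subsetIl subsetI subxx /= not_sub.
have prD2 : D \proper M2.
  by rewrite properE subsetIr subsetI subxx andbT not_sub // eq_sym.
have prDG : D \proper G := proper_trans prD1 pr1.
have prN := simple_norm_proper simG prDG ntD.
have [defN | [M3 max3 sN3]] := maximal_exists (proper_sub prN).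
  by rewrite defN properxx in prN.
have eq3 (A : {group gT}) : maximal A G -> D \proper A -> A = M3.
  move=> maxA prDA; apply/eqP; apply: contraT => neqA3.
  have prAG := maxgroupp maxA.
  have prDNA := nilpotent_proper_norm (nilG A prAG) prDA.
  have sNA3 : 'N_A(D) \subset A :&: M3.
    by rewrite subsetI subsetIl (subset_trans _ sN3) // setSI // proper_sub.
  have prDA3 : D \proper A :&: M3 := proper_sub_trans prDNA sNA3.
  have A31 : A :&: M3 = 1.
    apply: IHn => //; apply: leq_trans leDn; rewrite ltn_sub2l ?proper_card //.
  by rewrite A31 properE sub1G andbF in prDA3.
by rewrite (eq3 M1) // (eq3 M2) // eqxx in neq12.
Qed.

(** The maximal subgroups of such a group would be Frobenius complements, and
    the Frobenius kernel is then a proper nontrivial normal subgroup. *)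
Lemma simple_proper_nilpotent_solvable (gT : finGroupType) (G : {group gT}) :
    simple G -> (forall H : {group gT}, H \proper G -> nilpotent H) ->
  solvable G.
Proof.
move=> simG nilG; have [ntG simG'] := simpleP _ simG.
have [G1 | [M maxM _]] := maximal_exists (sub1G G); first by rewrite -G1 solvable1.
have [M1 | ntM] := eqVneq (M : {set gT}) 1.
  exact: trivial_maximal_solvable maxM M1.
have [prMG maxM'] := maxgroupP maxM; have sMG := proper_sub prMG.
have defNM : 'N_G(M) = M.
  apply: (maxM' 'N_G(M)%G); last by rewrite subsetI sMG normG.
  exact: simple_norm_proper.
have frobGM : [Frobenius G with complement M].
  rewrite /Frobenius_group_with_complement proper_neq //=.
  apply/normedTI_P; split.
  - by rewrite setD_eq0 subG1.
  - by rewrite normD1 subsetI sMG normG.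
  move=> g Gg; apply: contraR => nMg; rewrite -setI_eq0 conjD1g -setDIl setD_eq0.
  rewrite subG1; apply/eqP.
  apply: (@proper_nilpotent_maximal_TI _ G M (M :^ g)%G) => //.
    by rewrite -(conjGid Gg) maximalJ.
  apply: contraNneq nMg => /(congr1 val)/= defMg; rewrite -defNM inE Gg.
  by apply/normP.
have [K frobG] := Frobenius_kernel_exists frobGM.
have [defG _ _ prKG _] := Frobenius_context frobG.
have [nsK _ _ _ _] := sdprod_context defG.
have [K1 | KG] := simG' K nsK.
  by rewrite -(sdprodW defG) K1 mul1g properxx in prMG.
by rewrite KG properxx in prKG.
Qed.

(** For [h] in a proper subgroup above [M], the modular subgroup [M <*> M :^ h] is
    proper, so [h] normalises [M]: the normaliser [Z] of [M] contains all proper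
    subgroups above [M].  If [g] is a t-element outside [Z], then
    [M <*> <[g]> = G] and the second law gives [Z = M <*> (<[g]> :&: Z)], so
    that [Z / M] is a t-group.  If it is not trivial, t is determined, and all
    r-elements with [r != t] are in [Z]; they generate a normal subgroup. *)
Lemma simple_max_modular_maximal (gT : finGroupType) (G M : {group gT}) :
    simple G -> ~~ solvable G -> modular_subgroup G M -> M :!=: 1 -> M \proper G ->
    (forall L : {group gT}, modular_subgroup G L -> M \proper L -> L :=: G) ->
  maximal M G.
Proof.
move=> simG nsolG modM ntM prMG maxM; have sMG := proper_sub prMG.
pose Z := 'N_G(M)%G; have prZG : Z \proper G := simple_norm_proper simG prMG ntM.
have sMZ : M \subset Z by rewrite subsetI sMG normG.
have nsMZ : M <| Z by rewrite /normal sMZ subsetIr.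
have norm_over (H : {group gT}) : M \subset H -> H \proper G -> H \subset Z.
  move=> sMH prHG; have sHG := proper_sub prHG; rewrite subsetI sHG.
  apply/normsP=> h Hh; apply/eqP; rewrite eqEcard cardJg leqnn andbT.
  apply: contraT => nMMh.
  have defG : M <*> M :^ h = G.
    apply: (maxM (M <*> M :^ h)%G).
      by apply: modularY => //; apply: modularJ => //; apply: subsetP Hh.
    rewrite properE joing_subl; apply: contra nMMh; apply: subset_trans.
    exact: joing_subr.
  case/negP: (proper_subn prHG); rewrite -defG join_subG sMH.
  by rewrite -(conjGid Hh) conjSg.
have genG g : g \in G -> g \notin Z -> M <*> <[g]> = G.
  move=> Gg nZg; apply/eqP; rewrite eqEproper join_subG sMG cycle_subG Gg /=.
  apply: contra nZg => prMg; rewrite -cycle_subG.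
  by apply: subset_trans (norm_over _ _ prMg); rewrite ?joing_subl ?joing_subr.
have quoZ g t : t.-elt g -> g \in G -> g \notin Z -> t.-group (Z / M).
  move=> tg Gg nZg; have [_ _ mod2] := modM.
  have := mod2 <[g]>%G Z; rewrite cycle_subG Gg genG // => /(_ isT).
  rewrite (setIidPr (proper_sub prZG)) => defZ.
  rewrite -defZ ?(proper_sub prZG) // quotientYidl; last first.
    by rewrite subIset // subsetIr orbT.
  by apply: quotient_pgroup; apply: pgroupS (subsetIl _ _) tg.
have SylNZ : exists2 T : {group gT}, Sylow G T & ~~ (T \subset Z).
  have := proper_subn prZG; rewrite -{1}(Sylow_gen G) gen_subG.
  case/subsetPn=> x /bigcupP[T sylT Tx] nZx; exists T => //.
  by apply: contra nZx => /subsetP; apply.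
have [T /SylowP[t pr_t sylT] /subsetPn[g Tg nZg]] := SylNZ.
have Gg := subsetP (pHall_sub sylT) g Tg.
have tZM := quoZ g t (mem_p_elt (pHall_pgroup sylT) Tg) Gg nZg.
have defZ : Z :=: M.
  apply/eqP; rewrite eqEsubset sMZ andbT.
  have [r pr_r neq_rt] : exists2 r, r \in primes #|G| & r != t.
    have : ~~ t.-group G by apply: contra nsolG; apply: pgroup_sol.
    by rewrite /pgroup /pnat cardG_gt0 /= => /allPn[r]; exists r.
  have [S sylS] := Sylow_exists r G; have [sSG rS _] := and3P sylS.
  have ntS : S :!=: 1 by rewrite -rank_gt0 (rank_Sylow sylS) p_rank_gt0.
  apply: contraR ntS => nsZM.
  have ZrG s : r.-elt s -> s \in G -> s \in Z.
    move=> rs Gs; apply: contraR nsZM => nZs.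
    have rZM := quoZ s r rs Gs nZs.
    rewrite -quotient_sub1 ?normal_norm //.
    by rewrite -(coprime_TIg (coprime_pgroups neq_rt rZM tZM)) subsetIidl.
  have sKZ : <<class_support S G>> \subset Z.
    rewrite gen_subG; apply/subsetP=> _ /imset2P[s x Ss Gx ->].
    have Gs := subsetP sSG s Ss.
    by rewrite ZrG ?groupJ // p_eltJ (mem_p_elt rS).
  have nsK : <<class_support S G>> <| G.
    apply/andP; split; first exact: subset_trans sKZ (proper_sub prZG).
    exact/norms_gen/class_support_norm.
  have [_ simG'] := simpleP _ simG.
  have [K1 | KG] := simG' _ nsK; last first.
    by case/negP: (proper_subn prZG); rewrite -{1}KG.
  by rewrite -subG1 -K1 sub_gen // sub_class_support.
apply/maxgroupP; split=> // H prHG sMH; apply/eqP.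
by rewrite eqEsubset sMH andbT -defZ norm_over.
Qed.

(** Every conjugate [E] of [M] is a modular maximal subgroup, and the first law
    makes [E :&: X] maximal in [X] unless [X] is inside [E].  Hence
    maximal_modular_comm applies to the normaliser [X] of a Sylow subgroup [R]
    for the smallest prime divisor of the order of [G]. *)
Lemma simple_maximal_modular_solvable (gT : finGroupType) (G M : {group gT}) :
    simple G -> (forall H : {group gT}, H \proper G -> solvable H) ->
    modular_subgroup G M -> M :!=: 1 -> maximal M G ->
  solvable G.
Proof.
move=> simG solH modM ntM maxM; apply: contraT => nsolG.
have [ntG simG'] := simpleP _ simG.
have [prMG maxM'] := maxgroupP maxM; have sMG := proper_sub prMG.
pose q := pdiv #|G|; have pr_q : prime q by rewrite pdiv_prime // cardG_gt1.
have [R sylR] := Sylow_exists q G; have [sRG qR _] := and3P sylR.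
pose X := 'N_G(R)%G; have sXG : X \subset G := subsetIl _ _.
have ntR : R :!=: 1.
  by rewrite -rank_gt0 (rank_Sylow sylR) p_rank_gt0 mem_primes pr_q cardG_gt0 pdiv_dvd.
have prRG : R \proper G.
  rewrite properEneq sRG andbT; apply: contraNneq nsolG => <-.
  exact: pgroup_sol qR.
have solX : solvable X by apply: solH; apply: simple_norm_proper.
have nsRX : R <| X by rewrite /normal subsetI sRG normG subsetIr.
have comm_sub g : g \in G -> [~: R, X] \subset M :^ g.
  move=> Gg; set E := (M :^ g)%G.
  have modE : modular_subgroup G E := modularJ modM Gg.
  have maxE : maximal E G by rewrite -(conjGid Gg) maximalJ.
  have [_ maxE'] := maxgroupP maxE.
  have [sXE | nsXE] := boolP (X \subset E).
    apply: subset_trans sXE.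
    by rewrite commg_subr (subset_trans (normal_sub nsRX)) ?normG.
  apply: subset_trans (subsetIl E X).
  have modEX := modular_setI modE sXG.
  apply: (maximal_modular_comm (q := q) solX _ modEX _ qR nsRX); last first.
    move=> b pr_b b_X; rewrite pdiv_min_dvd ?prime_gt1 //.
    exact: dvdn_trans b_X (cardSg sXG).
  apply/maxgroupP; split; first by rewrite /= properE subsetIr subsetI subxx andbT.
  move=> Y prYX sEXY; have sYX := proper_sub prYX; have sYG := subset_trans sYX sXG.
  apply/eqP; rewrite eqEsubset sEXY subsetI sYX !andbT.
  apply: contraT => nsYE.
  have defG : Y <*> E = G.
    apply/eqP; rewrite eqEproper join_subG sYG (modular_sub modE) /=.
    apply: contra nsYE => prYE; rewrite -(maxE' _ prYE) ?joing_subl ?joing_subr //.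
  have [_ mod1 _] := modE; have := mod1 Y X sYX sXG.
  rewrite defG (setIidPr sXG) (joing_idPl sEXY) => defY.
  by rewrite defY properxx in prYX.
have sRXcore : [~: R, X] \subset gcore M G.
  by apply/bigcapsP=> g Gg; apply: comm_sub.
have core1 : gcore M G = 1.
  case: (simG' (gcore_group M G) (gcore_normal sMG)) => //= defcore.
  by case/negP: (proper_subn prMG); rewrite -{1}defcore gcore_sub.
have cRX : 'N_G(R) \subset 'C(R).
  by rewrite centsC; apply/commG1P/trivgP; rewrite -core1.
have tiRG' := Burnside_transfer sylR cRX.
case: (simG' _ (der_normal 1 G)) => [G'1 | G'G].
  by rewrite abelian_sol // in nsolG; apply/derG1P.
by rewrite G'G (setIidPl sRG) in tiRG'; rewrite tiRG' eqxx in ntR.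
Qed.

(** A proper modular subgroup larger than [M] can replace [M], so [M] may be assumed
    largest. *)
Lemma simple_modular_solvable (gT : finGroupType) (G M : {group gT}) :
    simple G -> (forall H : {group gT}, H \proper G -> solvable H) ->
    modular_subgroup G M -> M :!=: 1 -> M \proper G ->
  solvable G.
Proof.
move=> simG solH; have [n] := ubnP (#|G| - #|M|)%N.
elim: n => // n IHn in M * => /ltnSE-leMn modM ntM prMG; apply: contraT => nsolG.
have maxM : maximal M G.
  apply: simple_max_modular_maximal => // L modL prML.
  apply/eqP; apply: contraR nsolG => neqLG.
  have prLG : L \proper G by rewrite properEneq neqLG modular_sub.
  apply: (IHn L) => //; last by apply: subG1_contra ntM; apply: proper_sub.
  by apply: leq_trans leMn; rewrite ltn_sub2l ?proper_card.
by case/negP: nsolG; apply: simple_maximal_modular_solvable maxM.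
Qed.

Lemma coprime_modular_witness (gT : finGroupType) (G X : {group gT}) :
    coprime_modular G -> X \subset G -> solvable X -> ~~ nilpotent X ->
  exists M : {group gT}, [/\ modular_subgroup G M, M :!=: 1 & M \subset X].
Proof.
move=> modG sXG solX nnilX.
have nilXF := coprime_modular_metanilpotent solX (coprime_modularS sXG modG).
have [r [t [R [y [neq_rt rR nsRX [ty Xy nCy]]]]]] :=
  nilpotent_by_nilpotent_action nilXF nnilX.
have [k [nCyk Cyk]] := min_power_notin ty nCy.
set z := y ^+ (t ^ k)%N in nCyk; have Xz : z \in X by apply: groupX.
have sRX := normal_sub nsRX.
have [P0 [sP0R _ modM]] : exists P0 : {group gT},
    [/\ P0 \subset R, z \in 'N(P0) & modular_subgroup G (P0 <*> <[z]>)].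
  apply: (modG r t) => //.
  - exact: p_eltX.
  - exact: subset_trans sRX sXG.
  - exact: subsetP Xz.
  - by apply: subsetP Xz; apply: normal_norm.
  - by rewrite -expgM -expnSr.
exists (P0 <*> <[z]>)%G; split=> //.
  apply: contraNneq nCyk => M1.
  have : z \in P0 <*> <[z]> by rewrite (subsetP (joing_subr _ _)) ?cycle_id.
  by rewrite M1 => /set1P->; apply: group1.
by rewrite join_subG (subset_trans sP0R) // cycle_subG.
Qed.

Theorem coprime_modular_solvable (gT : finGroupType) (G : {group gT}) :
  coprime_modular G -> solvable G.
Proof.
have [n] := ubnP #|G|; elim: n => // n IHn in gT G * => /ltnSE-leGn modG.
have [-> | ntG] := eqsVneq G 1; first exact: solvable1.
have [N minN sNG] := minnormal_exists ntG (normG G).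
have [/andP[ntN nNG] _] := mingroupP minN.
have nsNG : N <| G by apply/andP.
have IHS (H : {group gT}) : H \proper G -> solvable H.
  move=> prHG; apply: IHn (coprime_modularS (proper_sub prHG) modG).
  exact: leq_trans (proper_card prHG) leGn.
have [eqNG | neqNG] := eqVneq (N : {set gT}) G; last first.
  rewrite (series_sol nsNG) IHS ?properEneq ?neqNG //=.
  apply: IHn (coprime_modular_quotient nsNG modG).
  by apply: leq_trans leGn; rewrite ltn_quotient.
have simG : simple G by rewrite /simple -{1}eqNG.
have [/forall_inP nilG | ] := boolP [forall (H : {group gT} | H \proper G), nilpotent H].
  exact: simple_proper_nilpotent_solvable.
case/forall_inPn=> X prXG nnilX; have sXG := proper_sub prXG.
have [M [modM ntM sMX]] := coprime_modular_witness modG sXG (IHS X prXG) nnilX.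
exact: (simple_modular_solvable simG IHS modM ntM (sub_proper_trans sMX prXG)).
Qed.

(** * Rank of the Sylow subgroups modulo the Fitting subgroup *)

(** A faithful irreducible representation of [Q] on [U] would make [Q] cyclic. *)
Lemma noncyclic_minnormal_cent (gT : finGroupType) (Q U : {group gT}) (p : nat) :
    p.-abelem U -> minnormal U Q -> abelian Q -> ~~ cyclic Q ->
  'C_Q(U) != 1.
Proof.
move=> abelU minU abQ; have [/andP[ntU nUQ] _] := mingroupP minU.
apply: contraNneq => CQU1.
have faithU := abelem_mx_faithful abelU ntU nUQ CQU1.
have irrU : mx_irreducible (abelem_repr abelU ntU nUQ) by apply/abelem_mx_irrP.
exact: mx_faithful_irr_abelian_cyclic faithU irrU abQ.

Qed.

(** A proper [H] would be contained in a proper normal subgroup [K], and [V / K]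
    would be perfect. *)
Lemma nilpotent_der1_supplement (gT : finGroupType) (V H : {group gT}) :
  nilpotent V -> H \subset V -> V^`(1) * H = V -> H :=: V.
Proof.
move=> nilV sHV defV; have snHV := nilpotent_subnormal nilV sHV.
have [-> // | [K [snHK nsKV prKV]]] := subnormalEr snHV.
have nKV := normal_norm nsKV.
have ntVK : V / K != 1.
  by rewrite -subG1 quotient_sub1 // proper_subn.
have := sol_der1_proper (nilpotent_sol (quotient_nil K nilV)) (subxx _) ntVK.
rewrite -quotient_der //= -{2}defV quotientMl ?(subset_trans (der_sub _ _)) //.
by rewrite (quotientS1 (subnormal_sub snHK)) mulg1 properxx.
Qed.

(** The join of [P0 <*> <[w]>] with [<[y ^ b]>] meets [V <*> <[w]>] in
    [P0 <*> <[w]>] only, and [~ w, [~ y, b]] = [~ w, y ^ b] lies in it. *)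
Lemma modular_commg_conj (gT : finGroupType) (G V Q P0 : {group gT})
    (w y b : gT) (q : nat) :
    modular_subgroup G (P0 <*> <[w]>) -> V <| G -> Q \subset G ->
    q^'.-group V -> q.-abelem Q -> w \in Q -> y \in Q -> y \notin <[w]> ->
    b \in V -> P0 \subset V -> w \in 'N(P0) ->
  [~ w, [~ y, b]] \in P0.
Proof.
move=> modM nsVG sQG q'V abelQ Qw Qy nwy Vb sP0V nP0w.
have [sVG nVG] := andP nsVG; have Gw := subsetP sQG w Qw; have Gy := subsetP sQG y Qy.
have qQ := abelem_pgroup abelQ; have abQ := abelem_abelian abelQ.
have nty : y != 1 by apply: contraNneq nwy => ->; apply: group1.
have nVw : <[w]> \subset 'N(V) by rewrite cycle_subG (subsetP nVG).
pose W := (V <*> <[w]>)%G; have defW : V * <[w]> = W by rewrite /= norm_joinEr.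
pose Y := <[y ^ b]>%G; pose M := (P0 <*> <[w]>)%G.
have defM : P0 * <[w]> = M by rewrite /= norm_joinEr ?cycle_subG.
have tiQV : Q :&: V = 1 := coprime_TIg (pnat_coprime qQ q'V).
have tiYW : Y :&: W = 1.
  apply: prime_TIg.
    rewrite -orderE orderJ (abelem_order_p abelQ) //.
    have ntQ : Q :!=: 1 by apply/trivgPn; exists y.
    by have [] := pgroup_pdiv qQ ntQ.
  have Wb : b \in W := subsetP (joing_subl V _) b Vb.
  rewrite cycle_subG groupJr //; apply: contra nwy => Wy.
  have : y \in Q :&: V * <[w]> by rewrite defW inE Qy.
  by rewrite -group_modr ?cycle_subG // tiQV mul1g.
have sMW : M \subset W by rewrite genS // setSU.
have sWG : W \subset G by rewrite join_subG sVG cycle_subG.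
have [_ _ mod2] := modM; have := mod2 Y W.
rewrite tiYW joingG1 cycle_subG groupJ ?(subsetP sVG b) // => /(_ isT sWG sMW) defMY.
have Vyb : [~ y, b] \in V.
  by rewrite commgEr groupM // memJ_norm ?groupV // (subsetP nVG).
have Vu : [~ w, [~ y, b]] \in V.
  by rewrite commgEr groupM // memJ_norm ?groupV // (subsetP nVG).
have eq_u : [~ w, [~ y, b]] = [~ w, y ^ b].
  rewrite conjg_mulR commgMJ; have /commgP/eqP-> := centsP abQ w Qw y Qy.
  by rewrite conj1g mulg1.
have Mw : w \in M := subsetP (joing_subr P0 _) w (cycle_id w).
have MYw : w \in (M <*> Y)%G := subsetP (joing_subl M Y) w Mw.
have MYyb : y ^ b \in (M <*> Y)%G := subsetP (joing_subr M Y) _ (cycle_id _).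
have Mu : [~ w, [~ y, b]] \in M.
  by rewrite [M : {set gT}]defMY inE (subsetP (joing_subl V _)) // eq_u groupR.
have tiwV : <[w]> :&: V = 1.
  by apply/trivgP; rewrite -tiQV setSI // cycle_subG.
have : [~ w, [~ y, b]] \in P0 * <[w]> :&: V by rewrite defM inE Mu.
by rewrite -group_modl // tiwV mulg1.
Qed.

(** Suppose [Q] acts faithfully.  Some [z != 1] in [Q] centralises an irreducible
    [U] on which [Q] acts nontrivially.  For [w] in [Q] outside [<[z]>] a
    modular [P0 <*> <[w]>] with [P0] in [U] exists, and then
    modular_commg_conj puts the elements [[~ w, [~ y, b]]], for [y] in [<[z]>]
    and [b] in [V], both in [[~: V, <[z]>]] and in the centraliser of [z], whose
    intersection is trivial.  So [w], and likewise [w * z], centralises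
    [[~: V, <[z]>]]; hence so does [z], which therefore centralises [V]. *)
Lemma coprime_modular_abelem2 (gT : finGroupType) (V Q : {group gT}) (q : nat) :
    prime q -> coprime_modular (V <*> Q) -> Q \subset 'N(V) -> abelian V ->
    q^'.-group V -> q.-abelem Q -> #|Q| = (q ^ 2)%N ->
  'C_Q(V) != 1.
Proof.
move=> pr_q modG nVQ abV q'V abelQ oQ; apply/eqP=> CQV1.
have qQ := abelem_pgroup abelQ; have abQ := abelem_abelian abelQ.
have coVQ : coprime #|V| #|Q| by rewrite coprime_sym (pnat_coprime qQ).
have ncycQ : ~~ cyclic Q by rewrite (abelem_cyclic abelQ) oQ pfactorK.
have ntW : [~: V, Q] != 1.
  apply: contraNneq ncycQ => /commG1P; rewrite centsC => cVQ.
  by rewrite -(setIidPl cVQ) CQV1 cyclic1.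
have [U minU sUW] := minnormal_exists ntW (commg_normr Q V).
have [/andP[ntU nUQ] _] := mingroupP minU.
have sWV : [~: V, Q] \subset V by rewrite commg_subl.
have sUV := subset_trans sUW sWV.
have [_ _ /is_abelemP[p pr_p abelU]] :=
  minnormal_solvable minU sUV (abelian_sol abV).
have pU := abelem_pgroup abelU.
have nCUQ : ~~ (Q \subset 'C(U)).
  apply: contra ntU => cUQ; rewrite -subG1 -(coprime_abel_cent_TI nVQ coVQ abV).
  by rewrite subsetI sUW centsC.
have [z /setIP[Qz CUz] ntz] := trivgPn _ (noncyclic_minnormal_cent abelU minU abQ ncycQ).
have oz : #[z] = q := abelem_order_p abelQ Qz ntz.
have nVz : <[z]> \subset 'N(V) by rewrite cycle_subG (subsetP nVQ).
have coVz : coprime #|V| #|<[z]>|.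
  by apply: coprime_dvdr coVQ; rewrite cardSg ?cycle_subG.
have tizw w : w \in Q -> w \notin <[z]> -> <[w]> :&: <[z]> = 1.
  move=> Qw nzw; apply: prime_TIg; last by rewrite cycle_subG.
  rewrite -orderE (abelem_order_p abelQ) //.
  by apply: contraNneq nzw => ->; apply: group1.
have defQ w : w \in Q -> w \notin <[z]> -> <[w]> * <[z]> = Q.
  move=> Qw nzw; have ntw : w != 1 by apply: contraNneq nzw => ->; apply: group1.
  apply/eqP; rewrite eqEcard mul_subG ?cycle_subG //= (TI_cardMg (tizw w _ _)) //.
  by rewrite -!orderE oz (abelem_order_p abelQ Qw ntw) oQ mulnn.
have sVG : V \subset V <*> Q := joing_subl V Q.
have sQG : Q \subset V <*> Q := joing_subr V Q.
have nsVG : V <| V <*> Q by rewrite /normal sVG join_subG normG.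
have CVzw w : w \in Q -> w \notin <[z]> -> w \in 'C([~: V, <[z]>]).
  move=> Qw nzw; have [P0 [sP0U nP0w modM]] : exists P0 : {group gT},
      [/\ P0 \subset U, w \in 'N(P0) & modular_subgroup (V <*> Q) (P0 <*> <[w]>)].
    apply: (modG p q) => //.
    - apply: contraNneq ntU => eq_pq; rewrite -subG1.
      have coUV : coprime #|U| #|V| by apply: pnat_coprime q'V; rewrite -eq_pq.
      by rewrite -(coprime_TIg coUV) subsetI subxx.
    - exact: mem_p_elt qQ Qw.
    - exact: subset_trans sVG.
    - exact: subsetP Qw.
    - exact: subsetP Qw.
    - apply: contra nCUQ => CUw.
      by rewrite -(defQ w) // mul_subG ?cycle_subG.
    - by have [_ expQ] := abelemP pr_q abelQ; rewrite expQ ?group1.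
  rewrite -sub_cent1 gen_subG.
  apply/subsetP=> _ /imset2P[b y Vb zy ->].
  have [-> | nty] := eqVneq y 1; first by rewrite commg1 group1.
  have nwy : y \notin <[w]>.
    apply: contra nty => wy; have : y \in <[w]> :&: <[z]> by rewrite inE wy.
    by rewrite tizw // inE.
  have Qy : y \in Q by apply: subsetP zy; rewrite cycle_subG.
  have P0u := modular_commg_conj modM nsVG sQG q'V abelQ Qw Qy nwy Vb
    (subset_trans sP0U sUV) nP0w.
  have Wyb : [~ y, b] \in [~: V, <[z]>] by rewrite -groupV invg_comm mem_commg.
  have nWw : w \in 'N([~: V, <[z]>]).
    rewrite -cycle_subG normsR ?cycle_subG ?(subsetP nVQ) //.
    rewrite (subsetP (cent_sub _)) // -cycle_subG.
    by rewrite (centSS _ _ abQ) ?cycle_subG.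
  have : [~ w, [~ y, b]] \in 'C_[~: V, <[z]>](<[z]>).
    rewrite inE commgEr groupM ?memJ_norm ?groupV //= -commgEr.
    by rewrite (subsetP _ _ P0u) // centsC cycle_subG (subsetP (centS sP0U)).
  rewrite coprime_abel_cent_TI // => /set1P u1.
  by rewrite -groupV invg_comm; apply/cent1P/commute_sym/commgP/eqP.
have [w Qw nzw] : exists2 w, w \in Q & w \notin <[z]>.
  apply/subsetPn; apply: contra ncycQ => sQz.
  by rewrite (cyclicS sQz) ?cycle_cyclic.
have Cw := CVzw w Qw nzw.
have Cwz : w * z \in 'C([~: V, <[z]>]).
  by apply: CVzw; [apply: groupM | rewrite groupMr ?cycle_id].
have Cz : <[z]> \subset 'C([~: V, <[z]>]).
  by rewrite cycle_subG -(groupMl z Cw).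
have : z \in 'C_Q(V).
  by rewrite inE Qz -cycle_subG coprime_cent_commg // abelian_sol.
by rewrite CQV1 inE (negbTE ntz).
Qed.

(** The preimage [Q1] of an elementary abelian subgroup of order [q ^ 2] would act on
    [V / V^`(1)] as the group excluded by coprime_modular_abelem2: an element of
    [Q1] that centralises [V / V^`(1)] centralises [V]. *)
Lemma coprime_modular_rank1 (gT : finGroupType) (V Q : {group gT}) (q : nat) :
    prime q -> q.-group Q -> nilpotent V -> q^'.-group V -> Q \subset 'N(V) ->
    coprime_modular (V <*> Q) ->
  'r_q(Q / 'C_Q(V)) <= 1.
Proof.
move=> pr_q qQ nilV q'V nVQ modG; rewrite leqNgt; apply/p_rank_geP=> -[E].
pose C := 'C_Q(V)%G; case/pnElemP=> sEQ abelE oE.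
have nsCQ : C <| Q by rewrite /normal subsetIl normsI ?normG ?norms_cent.
have [Q1 defE sCQ1 sQ1Q] := inv_quotientS nsCQ sEQ.
have nCQ1 := subset_trans sQ1Q (normal_norm nsCQ).
have nVQ1 := subset_trans sQ1Q nVQ; have qQ1 := pgroupS sQ1Q qQ.
have cCV : C \subset 'C(V) by rewrite subsetIr.
have nV'C : C \subset 'N(V^`(1)).
  by rewrite (char_norm_trans (der_char 1 V)) // cents_norm.
pose N := (V^`(1) <*> C)%G; have defN : V^`(1) * C = N by rewrite /= norm_joinEr.
have nNV : V \subset 'N(N) by rewrite normsY ?der_norm // cents_norm // centsC.
have nNQ1 : Q1 \subset 'N(N) by rewrite normsY // (char_norm_trans (der_char 1 V)).
pose G1 := (V <*> Q1)%G; have nsNG1 : N <| G1.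
  rewrite /normal !join_subG nNV nNQ1 (subset_trans (der_sub 1 V)) ?joing_subl //.
  by rewrite (subset_trans sCQ1) ?joing_subr.
have coVQ1 : coprime #|V| #|Q1| by rewrite coprime_sym (pnat_coprime qQ1).
have tiNQ1 : N :&: Q1 = C.
  rewrite -defN setIC -group_modr // (_ : _ :&: _ = 1) ?mul1g //.
  apply/trivgP; rewrite -(coprime_TIg coVQ1) setIC.
  exact: setIS (der_sub 1 V).
have tiNV : N :&: V = V^`(1).
  rewrite -defN -group_modl ?der_sub // (_ : _ :&: _ = 1) ?mulg1 //.
  apply/trivgP; rewrite -(coprime_TIg coVQ1) setIC.
  exact: setSI sCQ1.
have isoE : E \isog Q1 / N by have := second_isog nNQ1; rewrite tiNQ1 defE.
have modG1 : coprime_modular ((V / N) <*> (Q1 / N)).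
  have -> : ((V / N) <*> (Q1 / N))%G = (G1 / N)%G by apply: val_inj; rewrite /= quotientY.
  apply: coprime_modular_quotient nsNG1 (coprime_modularS _ modG).
  by rewrite genS // setUS.
have := @coprime_modular_abelem2 _ (V / N)%G (Q1 / N)%G q pr_q modG1.
case/(_ _ _ _ _ _)/trivgPn.
- exact: quotient_norms.
- by rewrite sub_der1_abelian // joing_subl.
- exact: quotient_pgroup.
- by rewrite -(isog_abelem isoE).
- by rewrite -(card_isog isoE) (card_pgroup (abelem_pgroup abelE)) oE.
move=> _ /setIP[/morphimP[x nNx Q1x ->] Cx] /eqP[]; apply: coset_id.
have nVx : <[x]> \subset 'N(V) by rewrite cycle_subG (subsetP nVQ1).
have CVx : 'C_V(<[x]>) = V.
  apply: (nilpotent_der1_supplement nilV (subsetIl _ _)).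
  apply: coprime_mul_cent => //.
  - exact: char_norm_trans (der_char 1 V) nVx.
  - exact: der_normal.
  - by apply: coprime_dvdr coVQ1; rewrite cardSg ?cycle_subG.
  - exact: nilpotent_sol.
  suffices: [~: V, <[x]>] \subset N :&: V by rewrite tiNV.
  rewrite subsetI commg_subl nVx andbT -quotient_cents2 ?cycle_subG //.
  by rewrite centsC quotient_cycle // cycle_subG.
rewrite (subsetP (joing_subr _ C)) // inE (subsetP sQ1Q) //=.
by rewrite -cycle_subG centsC -{1}CVx subsetIr.
Qed.

(** * Sylow 2-subgroups modulo the Fitting subgroup *)

(** Both cycles are the one spanned by a central element of order [q]. *)
Lemma rank1_prime_order_cycle (gT : finGroupType) (A : {group gT}) (q : nat) (x y : gT) :
    q.-group A -> 'r_q(A) <= 1 -> x \in A -> y \in A -> #[x] = q -> #[y] = q ->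
    prime q ->
  <[x]> = <[y]>.
Proof.
move=> qA rA Ax Ay ox oy pr_q.
have ntA : A :!=: 1.
  by apply/trivgPn; exists x; rewrite // -order_eq1 ox neq_ltn prime_gt1 ?orbT.
have [c Zc oc] : exists2 c, c \in 'Z(A) & #[c] = q.
  have ntZ : 'Z(A) != 1.
    by apply: contraNneq ntA => /(trivg_center_pgroup qA)->.
  have [_ q_Z _] := pgroup_pdiv (pgroupS (center_sub A) qA) ntZ.
  have [c Zc oc] := Cauchy pr_q q_Z; by exists c.
suff uniq z : z \in A -> #[z] = q -> <[z]> = <[c]> by rewrite !uniq.
move=> Az oz; apply/eqP; rewrite eqEcard -!orderE oc oz leqnn andbT.
apply: contraLR rA => nzc; rewrite -ltnNge.
have tizc : <[z]> :&: <[c]> = 1 by apply: prime_TIg; rewrite // -orderE oz.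
have [Ac cAc] := setIP Zc.
have defZC : <[z]> \x <[c]> = <[z]> <*> <[c]>.
  rewrite dprodEY // cent_cycle cycle_subG; apply/cent1P.
  exact: (centP cAc).
have := p_rankS q (_ : <[z]> <*> <[c]> \subset A).
rewrite join_subG !cycle_subG Az Ac => /(_ isT); apply: leq_trans.
have rk1 u : #[u] = q -> 0 < 'r_q(<[u]>).
  by move=> ou; rewrite p_rank_gt0 /= -orderE ou mem_primes pr_q prime_gt0 /=.
by rewrite -(p_rank_dprod q defZC) (leq_add (m1 := 1) (m2 := 1)) ?rk1.
Qed.

(** The modular Schmidt subgroup [<[x]> <*> <[e]>] joined with [<[y]>] meets
    [V <*> <[e]>] in [<[x]> <*> <[e]>] only, by the second law; hence the join,
    which contains [y], meets [V] in [<[x]>]. *)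
Lemma schmidt_norm_inverted (gT : finGroupType) (G V : {group gT}) (x e y : gT) :
    (forall S : {group gT}, S \subset G -> schmidt_group S ->
       modular_subgroup G S) ->
    V <| G -> 2^'.-group V -> x \in V -> prime #[x] -> x ^ e = x^-1 ->
    y \in G -> 2.-elt y -> e \in <[y]> ->
  y \in 'N(<[x]>).
Proof.
move=> modG nsVG oddV Vx pr_x xe Gy y2 ye; have [sVG nVG] := andP nsVG.
have Ge : e \in G by apply: subsetP ye; rewrite cycle_subG.
have e2 : 2.-elt e := mem_p_elt y2 ye.
have x2' : #[x] != 2.
  apply/eqP=> ox; have := mem_p_elt oddV Vx.
  by rewrite /p_elt ox.
have nxe : e \in 'N(<[x]>) by rewrite inE -cycleJ xe cycleV.
have xx : x ^+ 2 != 1 by rewrite -order_dvdn dvdn_prime2.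
have nCxe : e \notin 'C(<[x]>).
  rewrite cent_cycle; apply: contra xx => /cent1P cex.
  have /conjg_fixP : [~ x, e] == 1 by apply/commgP/commute_sym.
  by rewrite xe => /eqP; rewrite eq_invg_mul.
have Cxe2 : e ^+ 2 \in 'C(<[x]>).
  rewrite cent_cycle; apply/cent1P/commute_sym/commgP/conjg_fixP.
  by rewrite conjgM xe conjVg xe invgK.
have sxG : <[x]> \subset G by rewrite cycle_subG (subsetP sVG).
have p_x : #[x].-group <[x]> by rewrite /pgroup -orderE pnat_id.
have [P0 [sP0x nP0e nCP0e modM]] :=
  schmidt_coprime modG x2' p_x e2 sxG Ge nxe nCxe Cxe2.
have defP0 : P0 :=: <[x]>.
  apply/eqP; rewrite eqEsubset sP0x; apply: contraR nCP0e => nxP0.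
  have tixP0 : <[x]> :&: P0 = 1 by apply: prime_TIg.
  by rewrite -(setIidPr sP0x) tixP0 cent1T inE.
rewrite defP0 in modM.
have nVe : <[e]> \subset 'N(V) by rewrite cycle_subG (subsetP nVG).
pose W := (V <*> <[e]>)%G; have defW : V * <[e]> = W by rewrite /= norm_joinEr.
pose M := (<[x]> <*> <[e]>)%G.
have defM : <[x]> * <[e]> = M by rewrite /= norm_joinEr ?cycle_subG.
have tiyV : <[y]> :&: V = 1 := coprime_TIg (pnat_coprime y2 oddV).
have sey : <[e]> \subset <[y]> by rewrite cycle_subG.
have tieV : <[e]> :&: V = 1 by apply/trivgP; rewrite -tiyV setSI.
have defYW : <[y]> :&: W = <[e]> by rewrite -defW -group_modr // tiyV mul1g.
have sMW : M \subset W by rewrite genS // setSU // cycle_subG.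
have sWG : W \subset G by rewrite join_subG sVG cycle_subG.
have [_ _ mod2] := modM; have := mod2 <[y]>%G W.
rewrite defYW cycle_subG Gy => /(_ isT sWG sMW).
rewrite (joing_idPl (joing_subr _ _)) => defMy.
have defx : <[x]> = (M <*> <[y]>) :&: V.
  have -> : M <*> <[y]> :&: V = M :&: V.
    by rewrite -{1}(setIidPr (joing_subl V <[e]>)) setIA -defMy.
  by rewrite -defM -group_modl ?cycle_subG // tieV mulg1.
rewrite defx -cycle_subG normsI ?cycle_subG ?(subsetP nVG) //.
by rewrite (subsetP (normG _)) // (subsetP (joing_subr M _)) ?cycle_id.
Qed.

(** Otherwise the derived subgroup of [Q] contains an element [d] inducing an
    involution on [V].  As [Q / 'C_Q(V)] has rank 1, its nontrivial cyclic
    subgroups all contain that involution, so by schmidt_norm_inverted all of [Q] normalises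
    [<[x]>] when [d] inverts [x].  But then the derived subgroup centralises
    [x]. *)
Lemma schmidt_Sylow2_abelian (gT : finGroupType) (G V Q : {group gT}) :
    (forall S : {group gT}, S \subset G -> schmidt_group S ->
       modular_subgroup G S) ->
    V <| G -> 2^'.-group V -> Q \subset G -> 2.-group Q ->
    'r_2(Q / 'C_Q(V)) <= 1 ->
  abelian (Q / 'C_Q(V)).
Proof.
move=> modG nsVG oddV sQG Q2; pose C := 'C_Q(V)%G => rkA; have [sVG nVG] := andP nsVG.
have nCQ : Q \subset 'N(C).
  by rewrite normsI ?normG ?norms_cent // (subset_trans sQG).
have cCV : C \subset 'C(V) by rewrite subsetIr.
have A2 : 2.-group (Q / C) := quotient_pgroup C Q2.
apply: contraT => nabA.
have ntA' : (Q / C)^`(1) != 1 by apply: contra nabA => /eqP/derG1P.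
have [_ A'2 _] := pgroup_pdiv (pgroupS (der_sub 1 _) A2) ntA'.
have [db A'db odb] := Cauchy (isT : prime 2) A'2.
have Adb : db \in Q / C by apply: subsetP A'db; apply: der_sub.
have [d nCd [Q'd def_db]] : exists2 d, d \in 'N(C) & d \in Q^`(1) /\ db = coset C d.
  by move: A'db; rewrite /= -quotient_der // => /morphimP[d nCd Q'd ->]; exists d.
have Qd : d \in Q by apply: subsetP Q'd; apply: der_sub.
have nCVd : d \notin 'C(V).
  apply/negP=> CVd; have Cd : d \in C by rewrite inE Qd.
  by rewrite def_db (coset_id Cd) order1 in odb.
have CVd2 : d ^+ 2 \in 'C(V).
  apply: (subsetP cCV); apply: coset_idr; first exact: groupX.
  by rewrite morphX //= -def_db -odb expg_order.
have [v Vv nvd] : exists2 v, v \in V & v \notin 'C[d].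
  by apply/subsetPn; rewrite -cent_cycle centsC cycle_subG.
pose x0 := [~ v, d].
have Vx0 : x0 \in V.
  rewrite /x0 commgEl groupM ?groupV ?memJ_norm //.
  by rewrite (subsetP nVG) ?(subsetP sQG).
have x0d : x0 ^ d = x0^-1.
  have vdd : v ^ (d * d) = v.
    by apply/conjg_fixP/commgP/commute_sym; apply: (centP CVd2).
  by rewrite /x0 commgEl conjMg conjVg -conjgM vdd [RHS]invMg invgK.
have ntx0 : x0 != 1.
  by apply: contra nvd => /commgP/commute_sym cvd; apply/cent1P.
have pr_p : prime (pdiv #[x0]) by rewrite pdiv_prime // order_gt1.
have [x x0x ox] := Cauchy pr_p (pdiv_dvd #[x0]).
have pr_x : prime #[x] by rewrite ox.
have Vx : x \in V by apply: subsetP x0x; rewrite cycle_subG.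
have xd : x ^ d = x^-1.
  by have /cycleP[i ->] := x0x; rewrite conjXg x0d expgVn.
have nxQ : Q \subset 'N(<[x]>).
  apply/subsetP=> y Qy; have nCy := subsetP nCQ y Qy.
  have [CVy | nCVy] := boolP (y \in 'C(V)).
    apply: (subsetP (cent_sub _)); apply: subsetP CVy.
    by rewrite centS // cycle_subG.
  have ntyb : coset C y != 1.
    apply: contra nCVy => /eqP/(coset_idr nCy) Cy; exact: subsetP cCV y Cy.
  have Ayb : coset C y \in Q / C by apply: mem_quotient.
  have yb2 : 2.-group <[coset C y]> := mem_p_elt A2 Ayb.
  have [_ dvd2 _] := pgroup_pdiv yb2 (etrans (congr1 negb (cycle_eq1 _)) ntyb).
  have [u yu ou] := Cauchy (isT : prime 2) dvd2.
  have Au : u \in Q / C by apply: subsetP yu; rewrite cycle_subG.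
  have : db \in <[coset C y]>.
    rewrite (subsetP _ _ (cycle_id db)) //.
    by rewrite (rank1_prime_order_cycle A2 rkA Adb Au odb ou) // cycle_subG.
  case/cycleP=> m; rewrite def_db -morphX // => eq_dm.
  have Ce : y ^+ m * d^-1 \in C.
    apply: coset_idr; first by rewrite groupM ?groupX ?groupV.
    by rewrite morphM ?groupX ?groupV //= morphV //= eq_dm mulgV.
  apply: (schmidt_norm_inverted (e := y ^+ m) modG nsVG oddV) => //.
  - rewrite -(mulgKV d (y ^+ m)) conjgM -xd; congr (_ ^ d).
    apply/conjg_fixP/commgP/commute_sym.
    exact: (centP (subsetP cCV _ Ce)).
  - exact: subsetP sQG y Qy.
  - exact: mem_p_elt Q2 Qy.
  exact: mem_cycle.
have cxQ' : Q^`(1) \subset 'C[x].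
  rewrite gen_subG; apply/subsetP=> _ /imset2P[g h Qg Qh ->].
  by rewrite cyclic_norm_commg ?(subsetP nxQ).
have /conjg_fixP : [~ x, d] == 1.
  by apply/commgP/commute_sym/cent1P/(subsetP cxQ').
rewrite xd => /eqP; rewrite eq_invg_mul -[x * x]/(x ^+ 2) -order_dvdn.
rewrite dvdn_prime2 // => /eqP ox2.
by have := mem_p_elt oddV Vx; rewrite /p_elt ox2.
Qed.

Theorem corollary1p1 (gT : finGroupType) (G : {group gT}) :
  (forall S : {group gT}, S \subset G -> schmidt_group S ->
     modular_subgroup G S) ->
  cyclic (G / 'F(G)).
Proof.
move=> modG; have dd := schmidt_coprime_modular modG.
have nilGF := coprime_modular_metanilpotent (coprime_modular_solvable dd) dd.
apply: nil_Zgroup_cyclic => //; apply/forall_inP=> Qb /SylowP[q pr_q sylQb].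
set F := 'F(G) in nilGF Qb sylQb *; have nFG : G \subset 'N(F) := gFnorm _ _.
have [Q sylQ] := Sylow_exists q G; have [sQG qQ _] := and3P sylQ.
have nFQ := subset_trans sQG nFG.
have -> : Qb :=: Q / F.
  rewrite (nilpotent_Hall_pcore nilGF sylQb).
  by rewrite (nilpotent_Hall_pcore nilGF (quotient_pHall nFQ sylQ)).
have nilF : nilpotent F := Fitting_nil G.
pose V := 'O_q^'(F)%G; have nsVG : V <| G by rewrite !gFnormal_trans.
have q'V : q^'.-group V := pcore_pgroup _ _.
have nilV : nilpotent V := nilpotentS (pcore_sub _ _) nilF.
have [sVG nVG] := andP nsVG; have nVQ := subset_trans sQG nVG.
have defC : F :&: Q = 'C_Q(V).
  apply/eqP; rewrite eqEsubset !subsetI !subsetIr subsetIl /= andbT; apply/andP; split.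
    apply: (sub_nilpotent_cent2 nilF); rewrite ?pcore_sub ?subsetIl //.
    by rewrite coprime_sym (pnat_coprime (pgroupS (subsetIr _ _) qQ)).
  have nsFQ : F <*> Q <| G := Fitting_joing_Sylow_normal nilGF sylQ.
  have nsCFQ : 'C_Q(V) <| F <*> Q.
    rewrite /normal (subset_trans (subsetIl _ _)) ?joing_subr //=.
    rewrite norm_joinEr // (Fitting_mul_Sylow sylQ) mul_subG //.
      by rewrite cents_norm // centsC subsetIr.
    by rewrite normsI ?normG ?norms_cent.
  have nilC : nilpotent 'C_Q(V) := pgroup_nil (pgroupS (subsetIl _ _) qQ).
  apply: subset_trans (Fitting_max nsCFQ nilC) _.
  apply: Fitting_max (Fitting_nil _).
  exact: gFnormal_trans.
have isoQ : Q / 'C_Q(V) \isog Q / F.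
  by have := second_isog nFQ; rewrite defC.
rewrite -(isog_cyclic isoQ).
have rk1 : 'r_q(Q / 'C_Q(V)) <= 1.
  apply: coprime_modular_rank1 => //; apply: coprime_modularS dd.
  by rewrite join_subG sVG sQG.
have qA : q.-group (Q / 'C_Q(V)) := quotient_pgroup _ qQ.
have [q2 | odd_q] := even_prime pr_q.
  rewrite q2 in qQ q'V rk1 qA.
  rewrite abelian_rank1_cyclic ?(rank_pgroup qA) //.
  exact: (schmidt_Sylow2_abelian modG nsVG q'V sQG qQ rk1).
rewrite (odd_pgroup_rank1_cyclic qA) //.
rewrite odd_2'nat; apply: sub_in_pnat qA => r _ /eqP->; rewrite !inE.
by apply: contraTneq odd_q => ->.
Qed.
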